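(* Let $k\ge 2$ be an integer and let $a_1\in(0,1)$. The function $$f:\mathbb D\ni\lambda\mapsto \left(a_1\lambda^k,\ \sqrt{1-a_1^2}\,\lambda^{k+1}\right)$$ is a $(k+2)$-extremal in the unit ball $\mathbb B_2$ which is not a $(k+2)$-complex geodesic.
   Context: $\mathbb D$ is the open unit disc in $\mathbb C$ and $\mathbb B_2=\{z\in\mathbb C^2:|z_1|^2+|z_2|^2<1\}$ is the open Euclidean unit ball. Let $D$ be a domain in $\mathbb C^n$, $m\ge2$. A holomorphic map $f:\mathbb D\to D$ is an $m$-extremal if for every choice of pairwise distinct points $\lambda_1,\dots,\lambda_m\in\mathbb D$ there is no map $g$ holomorphic on a neighbourhood of $\overline{\mathbb D}$ with image in $D$ such that $g(\lambda_j)=f(\lambda_j)$ for $j=1,\dots,m$. A holomorphic map $f:\mathbb D\to D$ is an $m$-complex geodesic if there is a holomorphic function $F:D\to\mathbb D$ such that $F\circ f$ is a non-constant (finite) Blaschke product of degree at most $m-1$. A (finite) Blaschke product of degree $d$ is a function $\lambda\mapsto c\prod_{j=1}^{d}\frac{\alpha_j-\lambda}{1-\overline{\alpha_j}\lambda}$ with $|c|=1$ and $\alpha_j\in\mathbb D$. *)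

(* Defs.v *)
From Stdlib Require Import Reals List.
From Coquelicot Require Import Coquelicot.
Open Scope R_scope.

(* Complex (Fréchet) differentiability at every point of [Omega]; the filter
   [locally z] is the full neighbourhood filter, so [Omega] is meant to be
   open.  Functions are total, their values outside [Omega] are irrelevant. *)
Definition holomorphic_on {U V : NormedModule C_AbsRing}
    (Omega : U -> Prop) (f : U -> V) : Prop :=
  forall z : U, Omega z -> ex_filterdiff f (locally z).

Definition maps_into {S T : Type} (A : S -> Prop) (B : T -> Prop)
    (f : S -> T) : Prop :=
  forall x : S, A x -> B (f x).

Definition disc : C_NormedModule -> Prop := fun z => Cmod z < 1.
Definition closed_disc : C_NormedModule -> Prop := fun z => Cmod z <= 1.

Definition C2 : NormedModule C_AbsRing :=
  prod_NormedModule C_AbsRing C_NormedModule C_NormedModule.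

Definition ball2 : C2 -> Prop :=
  fun z => Cmod (fst z) ^ 2 + Cmod (snd z) ^ 2 < 1.

(* The points lambda_1, ..., lambda_m are the entries of a duplicate-free list
   of length [m]. *)
Definition extremal {V : NormedModule C_AbsRing} (D : V -> Prop) (m : nat)
    (f : C_NormedModule -> V) : Prop :=
  holomorphic_on disc f /\ maps_into disc D f /\
  forall pts : list C_NormedModule,
    length pts = m -> NoDup pts -> (forall l, In l pts -> disc l) ->
    ~ exists (Omega : C_NormedModule -> Prop) (g : C_NormedModule -> V),
        open Omega /\ (forall z, closed_disc z -> Omega z) /\
        holomorphic_on Omega g /\ maps_into Omega D g /\
        (forall l, In l pts -> g l = f l).

(* [alphas] lists the zeros with multiplicity, so that the degree is
   [length alphas]. *)
Definition blaschke (c : C) (alphas : list C) (l : C) : C :=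
  (c * fold_right Cmult 1
         (map (fun alpha => (alpha - l) / (1 - Cconj alpha * l)) alphas))%C.

Definition is_blaschke_of_degree (d : nat) (B : C -> C) : Prop :=
  exists (c : C) (alphas : list C),
    Cmod c = 1 /\ length alphas = d /\
    (forall alpha, In alpha alphas -> disc alpha) /\
    (forall l, disc l -> B l = blaschke c alphas l).

Definition complex_geodesic {V : NormedModule C_AbsRing} (D : V -> Prop)
    (m : nat) (f : C_NormedModule -> V) : Prop :=
  holomorphic_on disc f /\ maps_into disc D f /\
  exists F : V -> C_NormedModule,
    holomorphic_on D F /\ maps_into D disc F /\
    (exists d : nat, (d <= m - 1)%nat /\
       is_blaschke_of_degree d (fun l => F (f l))) /\
    (exists l1 l2, disc l1 /\ disc l2 /\ F (f l1) <> F (f l2)).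

(* Main.v *)
Require Import Defs.
From Stdlib Require Import Reals List Lra Lia Psatz ClassicalEpsilon.
From Coquelicot Require Import Coquelicot.
Open Scope R_scope.

(** Both halves compare holomorphic functions through integrals over the unit
    circle, which [circ] runs through once as its parameter goes from [0] to
    [1].  The only fact from function theory is [circle_integral_vanishing]: if
    [H] is complex differentiable on the closed disc and [o((z - p)^m)] at an
    interior point [p], then [z H(z) / (z - p)^(m+1)] has mean [0] over the
    circle.  As differentiability is assumed pointwise, without continuity of
    the derivative, it is deduced from Goursat's theorem, applied to the
    dilations of the circle towards [p].

    Write [b = sqrt (1 - a1^2)].  On the circle [f] has norm [1], and the
    Hermitian product of [g] and [f] is [conj z ^ (k+1)] times the function
    [h = a1 z g1 + b g2].  If [g] maps the closed disc into the ball, then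
    [|h| < 1] there, and if [g] agrees with [f] at [k + 2] points of the disc,
    then [h] agrees with [z ^ (k+1)] at these points, which is one point too
    many ([no_contractive_interpolation]).  The argument replaces Rouche's theorem
    by duality: with [q] the polynomial that vanishes at the points,
    [(1 - h * conj z ^ (k+1)) / |q|^2] has positive real part and mean [0].

    Suppose now that [F o f] is a Blaschke product [B] of degree
    [d <= k + 1].  A disc automorphism [m] sends [F 0] to [0]; let
    [al * z1 + be * z2] be the linear part of [m o F] at the origin.  The
    Schwarz lemma on the slices of the ball gives [|al|^2 + |be|^2 <= 1] and an
    error of order two ([ball_first_order]).  Since [2 k >= k + 2], the function
    [h = m^(-1) (al a1 z^k + be b z^(k+1))] agrees with [B] up to an error
    [O(z^(k+2))].  It is bounded by [1], and the same duality, now with weight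
    [|Q|^2] for [Q] the denominator of [B], forces [|h| = 1] on the circle
    ([blaschke_rigidity]).  Hence [|al a1 + be b z| = 1] on the circle, so
    [|al a1|^2 + |be b|^2 = 1], which is impossible as [a1] and [b] are less
    than [1]. *)

(** * Continuity and complex derivatives *)

Lemma continuous_pair (T : UniformSpace) (f g : T -> R) (x : T) :
  continuous f x -> continuous g x ->
  continuous (fun t => (f t, g t) : C) x.
Proof.
  intros Hf Hg P [eps HP].
  assert (Hf' := Hf _ (locally_ball (f x) eps)).
  assert (Hg' := Hg _ (locally_ball (g x) eps)).
  unfold filtermap in *.
  generalize (filter_and _ _ Hf' Hg'); apply filter_imp.
  intros t [H1 H2]; apply HP; split; assumption.
Qed.

Lemma continuous_Re (T : UniformSpace) (f : T -> C) (x : T) :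
  continuous f x -> continuous (fun t => Re (f t)) x.
Proof.
  intros Hf; apply (continuous_comp f fst x Hf).
  apply (continuous_fst (U := R_UniformSpace) (V := R_UniformSpace)).
Qed.

Lemma continuous_Im (T : UniformSpace) (f : T -> C) (x : T) :
  continuous f x -> continuous (fun t => Im (f t)) x.
Proof.
  intros Hf; apply (continuous_comp f snd x Hf).
  apply (continuous_snd (U := R_UniformSpace) (V := R_UniformSpace)).
Qed.

Lemma continuous_Cplus (T : UniformSpace) (f g : T -> C) (x : T) :
  continuous f x -> continuous g x -> continuous (fun t => (f t + g t)%C) x.
Proof.
  intros Hf Hg; apply continuous_pair.
  - exact (continuous_plus (V := R_NormedModule) _ _ x
             (continuous_Re _ _ _ Hf) (continuous_Re _ _ _ Hg)).
  - exact (continuous_plus (V := R_NormedModule) _ _ x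
             (continuous_Im _ _ _ Hf) (continuous_Im _ _ _ Hg)).
Qed.

Lemma continuous_Cmult (T : UniformSpace) (f g : T -> C) (x : T) :
  continuous f x -> continuous g x -> continuous (fun t => (f t * g t)%C) x.
Proof.
  intros Hf Hg.
  assert (Hf1 := continuous_Re _ _ _ Hf); assert (Hf2 := continuous_Im _ _ _ Hf).
  assert (Hg1 := continuous_Re _ _ _ Hg); assert (Hg2 := continuous_Im _ _ _ Hg).
  assert (M := fun u v => continuous_mult (K := R_AbsRing) (U := T) u v x).
  apply continuous_pair.
  - exact (continuous_minus (V := R_NormedModule) _ _ x
             (M _ _ Hf1 Hg1) (M _ _ Hf2 Hg2)).
  - exact (continuous_plus (V := R_NormedModule) _ _ x
             (M _ _ Hf1 Hg2) (M _ _ Hf2 Hg1)).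
Qed.

Lemma continuous_Copp (T : UniformSpace) (f : T -> C) (x : T) :
  continuous f x -> continuous (fun t => (- f t)%C) x.
Proof.
  intros Hf; apply continuous_pair.
  - exact (continuous_opp (V := R_NormedModule) _ x (continuous_Re _ _ _ Hf)).
  - exact (continuous_opp (V := R_NormedModule) _ x (continuous_Im _ _ _ Hf)).
Qed.

Lemma continuous_Cconj (T : UniformSpace) (f : T -> C) (x : T) :
  continuous f x -> continuous (fun t => Cconj (f t)) x.
Proof.
  intros Hf; apply continuous_pair.
  - exact (continuous_Re _ _ _ Hf).
  - exact (continuous_opp (V := R_NormedModule) _ x (continuous_Im _ _ _ Hf)).
Qed.

Lemma continuous_Cinv (T : UniformSpace) (f : T -> C) (x : T) :
  continuous f x -> f x <> 0 -> continuous (fun t => (/ f t)%C) x.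
Proof.
  intros Hf Hnz.
  assert (Hf1 := continuous_Re _ _ _ Hf); assert (Hf2 := continuous_Im _ _ _ Hf).
  assert (M := fun u v => continuous_mult (K := R_AbsRing) (U := T) u v x).
  assert (Hd : continuous (fun t => / (fst (f t) ^ 2 + snd (f t) ^ 2)) x).
  { apply continuous_comp with (g := Rinv).
    - assert (Hone : continuous (fun _ : T => 1) x) by apply continuous_const.
      exact (continuous_plus (V := R_NormedModule) _ _ x
               (M _ _ Hf1 (M _ _ Hf1 Hone)) (M _ _ Hf2 (M _ _ Hf2 Hone))).
    - apply continuous_Rinv; intros H0; apply Hnz.
      destruct (f x) as [u v]; simpl in H0.
      apply injective_projections; simpl; nra. }
  unfold Cinv; apply continuous_pair.
  - exact (M _ _ Hf1 Hd).
  - exact (M _ _ (continuous_opp (V := R_NormedModule) _ x Hf2) Hd).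
Qed.

Lemma continuous_Cpow (T : UniformSpace) (f : T -> C) (x : T) (n : nat) :
  continuous f x -> continuous (fun t => (f t ^ n)%C) x.
Proof.
  intros Hf; induction n as [|n IH]; simpl.
  - apply continuous_const.
  - apply continuous_Cmult; assumption.
Qed.

Lemma Cmod_neq_0 (z : C) : 0 < Cmod z -> z <> 0.
Proof. apply Cmod_gt_0. Qed.

(** Neighbourhoods in [C] are those of the product [R * R], whose balls are
    squares; discs give the same filter. *)
Lemma locally_Cmod (P : C -> Prop) (z : C) :
  locally z P <->
  exists del, 0 < del /\ forall w, Cmod (w - z) < del -> P w.
Proof.
  split.
  - intros [del Hdel]; exists del; split; [apply cond_pos|].
    intros w Hw; apply Hdel, (C_NormedModule_mixin_compat1 z w del Hw).
  - intros [del [Hdel Hw]].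
    assert (H2 : 0 < sqrt 2) by (apply sqrt_lt_R0; lra).
    assert (He : 0 < del / sqrt 2) by (apply Rdiv_lt_0_compat; assumption).
    exists (mkposreal _ He); intros w Hb; apply Hw.
    apply C_NormedModule_mixin_compat2 in Hb; simpl in Hb.
    replace del with (sqrt 2 * (del / sqrt 2)) by (field; lra).
    exact Hb.
Qed.

Lemma continuous_C_iff (f : C -> C) (z : C) :
  continuous f z <->
  forall eps, 0 < eps -> exists del, 0 < del /\
    forall w, Cmod (w - z) < del -> Cmod (f w - f z) < eps.
Proof.
  split.
  - intros Hf eps Heps.
    apply (locally_Cmod (fun w => Cmod (f w - f z) < eps)).
    apply (Hf (fun y => Cmod (y - f z) < eps)), locally_Cmod.
    exists eps; auto.
  - intros Hf P HP; apply locally_Cmod in HP; destruct HP as [eps [Heps HP]].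
    destruct (Hf eps Heps) as [del [Hdel Hw]].
    apply locally_Cmod; exists del; auto.
Qed.

(** Caratheodory's form of the complex derivative: the difference quotient
    extends continuously to the point.  Products and inverses then reduce to
    algebra on the quotients. *)
Definition Cderive_at (g : C -> C) (z l : C) : Prop :=
  exists phi : C -> C, continuous phi z /\ phi z = l /\
    forall w, g w = (g z + phi w * (w - z))%C.

Definition Cdiff (g : C -> C) (z : C) : Prop := exists l, Cderive_at g z l.

Lemma Cderive_at_eq (g : C -> C) (z l l' : C) :
  l = l' -> Cderive_at g z l -> Cderive_at g z l'.
Proof. intros ->; trivial. Qed.

Lemma Cdiff_continuous (g : C -> C) (z : C) : Cdiff g z -> continuous g z.
Proof.
  intros [l [phi [Hc [_ Hg]]]].
  apply continuous_ext with (fun w => (g z + phi w * (w - z))%C).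
  - intros w; symmetry; apply Hg.
  - apply continuous_Cplus; [apply continuous_const|].
    apply continuous_Cmult; [assumption|].
    apply continuous_Cplus; [apply continuous_id | apply continuous_const].
Qed.

Lemma Cderive_at_const (c z : C) : Cderive_at (fun _ => c) z 0.
Proof.
  exists (fun _ => 0); repeat split; [apply continuous_const|].
  intros w; ring.
Qed.

Lemma Cderive_at_id (z : C) : Cderive_at (fun w => w) z 1.
Proof.
  exists (fun _ => 1); repeat split; [apply continuous_const|].
  intros w; ring.
Qed.

Lemma Cderive_at_opp (f : C -> C) (z a : C) :
  Cderive_at f z a -> Cderive_at (fun w => (- f w)%C) z (- a)%C.
Proof.
  intros [p [Hp [Ep Hf]]].
  exists (fun w => (- p w)%C); repeat split.
  - apply continuous_Copp; assumption.
  - rewrite Ep; reflexivity.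
  - intros w; rewrite (Hf w); ring.
Qed.

Lemma Cderive_at_plus (f g : C -> C) (z a b : C) :
  Cderive_at f z a -> Cderive_at g z b ->
  Cderive_at (fun w => (f w + g w)%C) z (a + b)%C.
Proof.
  intros [p [Hp [Ep Hf]]] [q [Hq [Eq Hg]]].
  exists (fun w => (p w + q w)%C); repeat split.
  - apply continuous_Cplus; assumption.
  - rewrite Ep, Eq; reflexivity.
  - intros w; rewrite (Hf w), (Hg w); ring.
Qed.

Lemma Cderive_at_mult (f g : C -> C) (z a b : C) :
  Cderive_at f z a -> Cderive_at g z b ->
  Cderive_at (fun w => (f w * g w)%C) z (a * g z + f z * b)%C.
Proof.
  intros [p [Hp [Ep Hf]]] [q [Hq [Eq Hg]]].
  exists (fun w => (p w * g w + f z * q w)%C); repeat split.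
  - apply continuous_Cplus; apply continuous_Cmult; try assumption.
    + apply Cdiff_continuous; exists b, q; auto.
    + apply continuous_const.
  - rewrite Ep, Eq; reflexivity.
  - intros w; rewrite (Hf w), (Hg w); ring.
Qed.

Lemma Cderive_at_scaled_id (A z : C) : Cderive_at (fun w => (A * w)%C) z A.
Proof.
  exists (fun _ => A); repeat split; [apply continuous_const|].
  intros w; ring.
Qed.

Lemma Cdiff_const (c z : C) : Cdiff (fun _ => c) z.
Proof. eexists; apply Cderive_at_const. Qed.

Lemma Cdiff_id (z : C) : Cdiff (fun w => w) z.
Proof. eexists; apply Cderive_at_id. Qed.

Lemma Cdiff_plus (f g : C -> C) (z : C) :
  Cdiff f z -> Cdiff g z -> Cdiff (fun w => (f w + g w)%C) z.
Proof. intros [a Ha] [b Hb]; eexists; apply Cderive_at_plus; eassumption. Qed.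

Lemma Cdiff_mult (f g : C -> C) (z : C) :
  Cdiff f z -> Cdiff g z -> Cdiff (fun w => (f w * g w)%C) z.
Proof. intros [a Ha] [b Hb]; eexists; apply Cderive_at_mult; eassumption. Qed.

Lemma Cdiff_opp (f : C -> C) (z : C) :
  Cdiff f z -> Cdiff (fun w => (- f w)%C) z.
Proof. intros [a Ha]; eexists; apply Cderive_at_opp; eassumption. Qed.

Lemma Cdiff_minus (f g : C -> C) (z : C) :
  Cdiff f z -> Cdiff g z -> Cdiff (fun w => (f w - g w)%C) z.
Proof. intros Hf Hg; apply Cdiff_plus; [|apply Cdiff_opp]; assumption. Qed.

(** At the points where [f] vanishes the quotient of [/ f] is not given by the
    formula [- p w / (f w * f z)]; since [f z <> 0] these points stay away from
    [z], and any value, here the honest difference quotient, will do there. *)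
Lemma Cderive_at_inv (f : C -> C) (z a : C) :
  Cderive_at f z a -> f z <> 0 ->
  Cderive_at (fun w => (/ f w)%C) z (- a / (f z * f z))%C.
Proof.
  intros Ha Hnz.
  assert (Hcf : continuous f z) by (apply Cdiff_continuous; exists a; exact Ha).
  destruct Ha as [p [Hp [Ep Hf]]].
  exists (fun w => if Ceq_dec (f w) 0 then ((/ f w - / f z) / (w - z))%C
                   else (- p w * (/ f w * / f z))%C).
  split; [|split].
  - apply continuous_ext_loc with (fun w => (- p w * (/ f w * / f z))%C).
    + assert (Hpos : 0 < Cmod (f z)) by (apply Cmod_gt_0; assumption).
      destruct (proj1 (continuous_C_iff f z) Hcf _ Hpos) as [del [Hdel Hw]].
      apply locally_Cmod; exists del; split; [assumption|]; intros w Hb.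
      destruct (Ceq_dec (f w) 0) as [E|E]; [exfalso|reflexivity].
      specialize (Hw w Hb); rewrite E in Hw.
      replace (0 - f z)%C with (- f z)%C in Hw by ring.
      rewrite Cmod_opp in Hw; lra.
    + apply continuous_Cmult; [apply continuous_Copp; assumption|].
      apply continuous_Cmult; [apply continuous_Cinv; assumption|].
      apply continuous_const.
  - destruct (Ceq_dec (f z) 0); [contradiction|].
    rewrite Ep; field; assumption.
  - intros w; destruct (Ceq_dec (f w) 0) as [E|E].
    + assert (w - z <> 0)%C.
      { intros E'; apply Hnz; rewrite (Hf w), E' in E.
        rewrite <- E; ring. }
      generalize (/ f w)%C; intros c; field; split; assumption.
    + replace (- p w * (/ f w * / f z) * (w - z))%C
        with (- (p w * (w - z)) * (/ f w * / f z))%C by ring.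
      replace (p w * (w - z))%C with (f w - f z)%C
        by (rewrite (Hf w) at 1; ring).
      field; split; assumption.
Qed.

Lemma Cdiff_inv (f : C -> C) (z : C) :
  Cdiff f z -> f z <> 0 -> Cdiff (fun w => (/ f w)%C) z.
Proof. intros [a Ha] Hz; eexists; apply Cderive_at_inv; eassumption. Qed.

Lemma Cdiff_div (f g : C -> C) (z : C) :
  Cdiff f z -> Cdiff g z -> g z <> 0 -> Cdiff (fun w => (f w / g w)%C) z.
Proof.
  intros Hf Hg Hz; apply Cdiff_mult; [|apply Cdiff_inv]; assumption.
Qed.

Lemma Cdiff_pow (f : C -> C) (n : nat) (z : C) :
  Cdiff f z -> Cdiff (fun w => (f w ^ n)%C) z.
Proof.
  intros Hf; induction n as [|n IH]; simpl.
  - apply Cdiff_const.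
  - apply Cdiff_mult; assumption.
Qed.

(** The order of vanishing that makes the mean of [z H(z) / (z - p)^2] over
    the circle vanish. *)
Lemma Cderive_at_order (H : C -> C) (p : C) :
  Cderive_at H p 0 -> H p = 0 ->
  forall eta, 0 < eta -> exists del, 0 < del /\
    forall w, Cmod (w - p) < del -> Cmod (H w) <= eta * Cmod (w - p) ^ 1.
Proof.
  intros [phi [Hc [E0 Hphi]]] Hp eta Heta.
  destruct (proj1 (continuous_C_iff phi p) Hc eta Heta) as [del [Hdel Hw]].
  exists del; split; [assumption|]; intros w Hwd.
  rewrite (Hphi w), Hp, Cplus_0_l, Cmod_mult, pow_1.
  apply Rmult_le_compat_r; [apply Cmod_ge_0|].
  specialize (Hw w Hwd); rewrite E0 in Hw.
  replace (phi w - 0)%C with (phi w) in Hw by ring; lra.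
Qed.

(** A complex linear map of [C] is the multiplication by its value at [1],
    which is thus the derivative. *)
Lemma Cderive_at_filterdiff (f l : C -> C) (z : C) :
  filterdiff (U := C_NormedModule) (V := C_NormedModule) f (locally z) l ->
  Cderive_at f z (l (RtoC 1)).
Proof.
  intros [Hl Hd].
  assert (Hlin : forall w : C, l w = (w * l (RtoC 1))%C).
  { intros w; replace (w : C_NormedModule)
      with (scal w (RtoC 1 : C_NormedModule)) at 1.
    - rewrite (linear_scal _ Hl); reflexivity.
    - apply Cmult_1_r. }
  specialize (Hd z (fun P H => H)).
  exists (fun w =>
    if Ceq_dec w z then l (RtoC 1) else ((f w - f z) / (w - z))%C).
  split; [|split].
  - apply continuous_C_iff; intros eps Heps.
    destruct (Ceq_dec z z) as [_|]; [|congruence].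
    assert (He : 0 < eps / 2) by lra.
    specialize (Hd (mkposreal _ He)); apply locally_Cmod in Hd.
    destruct Hd as [del [Hpos Hdel]].
    exists del; split; [assumption|]; intros w Hw.
    destruct (Ceq_dec w z) as [E|E].
    + replace (l (RtoC 1) - l (RtoC 1))%C with (0 : C) by ring.
      rewrite Cmod_0; exact Heps.
    + specialize (Hdel w Hw).
      simpl in Hdel.
      assert (Hnz : (w - z <> 0)%C).
      { intros E'; apply E; replace w with (w - z + z)%C by ring.
        rewrite E'; ring. }
      assert (Hm : 0 < Cmod (w - z)) by (apply Cmod_gt_0; assumption).
      change (Cmod (f w - f z - l (w - z)%C) <= eps / 2 * Cmod (w - z)) in Hdel.
      rewrite Hlin in Hdel.
      replace ((f w - f z) / (w - z) - l (RtoC 1))%C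
        with ((f w - f z - (w - z) * l (RtoC 1)) / (w - z))%C by (field; assumption).
      rewrite Cmod_div by assumption.
      apply Rle_lt_trans with (eps / 2); [|lra].
      apply Rmult_le_reg_r with (Cmod (w - z)); [assumption|].
      unfold Rdiv at 1; rewrite Rmult_assoc, Rinv_l by lra; lra.
  - destruct (Ceq_dec z z); [reflexivity|congruence].
  - intros w; destruct (Ceq_dec w z) as [E|E].
    + rewrite E; ring.
    + field; intros E'; apply E; replace w with (w - z + z)%C by ring.
      rewrite E'; ring.
Qed.

Lemma filterdiff_Cderive_at (f : C -> C) (z l : C) :
  Cderive_at f z l ->
  filterdiff (U := C_NormedModule) (V := C_NormedModule) f (locally z)
    (fun w => (w * l)%C).
Proof.
  intros [p [Hp [Ep Hf]]]; split.
  - split.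
    + intros x y; apply Cmult_plus_distr_r.
    + intros k x; symmetry; apply Cmult_assoc.
    + exists (Cmod l + 1); split; [generalize (Cmod_ge_0 l); lra|].
      intros x; change (Cmod (x * l) <= (Cmod l + 1) * Cmod x).
      rewrite Cmod_mult; generalize (Cmod_ge_0 x); lra.
  - intros x Hx eps.
    rewrite <- (is_filter_lim_locally_unique (V := C_NormedModule) z x Hx).
    clear x Hx.
    destruct (proj1 (continuous_C_iff p z) Hp eps (cond_pos eps))
      as [del [Hdel Hw]].
    apply locally_Cmod; exists del; split; [assumption|]; intros w Hb.
    change (Cmod (f w - f z - (w - z) * l) <= eps * Cmod (w - z)).
    replace (f w - f z - (w - z) * l)%C with ((p w - p z) * (w - z))%C
      by (rewrite (Hf w), Ep; ring).
    rewrite Cmod_mult; apply Rmult_le_compat_r; [apply Cmod_ge_0|].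
    left; apply Hw; exact Hb.
Qed.

(** * Integrals of complex-valued functions of a real variable *)

Definition is_CInt (f : R -> C) (a b : R) (I : C) : Prop :=
  is_RInt (V := C_R_NormedModule) f a b I.

Definition CInt (f : R -> C) (a b : R) : C :=
  RInt (V := C_R_CompleteNormedModule) f a b.

Lemma is_CInt_CInt (f : R -> C) (a b : R) :
  a <= b -> (forall t, a <= t <= b -> continuous f t) ->
  is_CInt f a b (CInt f a b).
Proof.
  intros Hab Hf.
  apply (RInt_correct (V := C_R_CompleteNormedModule)).
  apply (ex_RInt_continuous (V := C_R_CompleteNormedModule)).
  rewrite Rmin_left, Rmax_right by assumption; exact Hf.
Qed.

Lemma is_CInt_eq (f : R -> C) (a b : R) (I : C) :
  is_CInt f a b I -> CInt f a b = I.
Proof. apply (is_RInt_unique (V := C_R_CompleteNormedModule)). Qed.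

Lemma is_CInt_ext (f g : R -> C) (a b : R) (I : C) :
  a <= b -> (forall t, a <= t <= b -> f t = g t) ->
  is_CInt f a b I -> is_CInt g a b I.
Proof.
  intros Hab H; apply (is_RInt_ext (V := C_R_NormedModule)).
  rewrite Rmin_left, Rmax_right by assumption; intros t Ht; apply H; lra.
Qed.

Lemma is_CInt_const_01 (c : C) : is_CInt (fun _ => c) 0 1 c.
Proof.
  assert (H := is_RInt_const (V := C_R_NormedModule) 0 1 c).
  replace (scal (1 - 0) (c : C_R_NormedModule) : C) with c in H; [exact H|].
  apply injective_projections; simpl; unfold scal; simpl; unfold mult; simpl; ring.
Qed.

Lemma is_CInt_parts (f : R -> C) (a b : R) (I : C) :
  is_CInt f a b I <->
  is_RInt (fun t => Re (f t)) a b (Re I) /\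
  is_RInt (fun t => Im (f t)) a b (Im I).
Proof.
  split.
  - intros H; split.
    + exact (is_RInt_fct_extend_fst (U := R_NormedModule) (V := R_NormedModule)
               f a b I H).
    + exact (is_RInt_fct_extend_snd (U := R_NormedModule) (V := R_NormedModule)
               f a b I H).
  - intros [H1 H2]; rewrite (surjective_pairing I).
    exact (is_RInt_fct_extend_pair (U := R_NormedModule) (V := R_NormedModule)
             f a b _ _ H1 H2).
Qed.

Lemma is_CInt_plus (f g : R -> C) (a b : R) (I J : C) :
  is_CInt f a b I -> is_CInt g a b J ->
  is_CInt (fun t => (f t + g t)%C) a b (I + J)%C.
Proof. apply (is_RInt_plus (V := C_R_NormedModule)). Qed.

Lemma is_CInt_minus (f g : R -> C) (a b : R) (I J : C) :
  is_CInt f a b I -> is_CInt g a b J ->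
  is_CInt (fun t => (f t - g t)%C) a b (I - J)%C.
Proof. apply (is_RInt_minus (V := C_R_NormedModule)). Qed.

Lemma is_CInt_scal (c : C) (f : R -> C) (a b : R) (I : C) :
  is_CInt f a b I -> is_CInt (fun t => (c * f t)%C) a b (c * I)%C.
Proof.
  rewrite !is_CInt_parts; intros [H1 H2]; destruct c as [c d]; simpl.
  assert (S := fun k f I H => is_RInt_scal (V := R_NormedModule) f a b k I H).
  split.
  - exact (is_RInt_minus _ _ _ _ _ _ (S c _ _ H1) (S d _ _ H2)).
  - exact (is_RInt_plus _ _ _ _ _ _ (S c _ _ H2) (S d _ _ H1)).
Qed.

Lemma is_CInt_Chasles (f : R -> C) (a b c : R) (I J : C) :
  is_CInt f a b I -> is_CInt f b c J -> is_CInt f a c (I + J)%C.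
Proof. apply (is_RInt_Chasles (V := C_R_NormedModule)). Qed.

Lemma CInt_Chasles (f : R -> C) (a b c : R) :
  a <= b -> b <= c -> (forall t, a <= t <= c -> continuous f t) ->
  CInt f a c = (CInt f a b + CInt f b c)%C.
Proof.
  intros Hab Hbc Hf; apply is_CInt_eq, is_CInt_Chasles with b;
    apply is_CInt_CInt; try assumption; intros t Ht; apply Hf; lra.
Qed.

Lemma Cmod_norm_R (z : C) : norm (z : C_R_NormedModule) = Cmod z.
Proof.
  change (sqrt (Rabs (fst z) ^ 2 + Rabs (snd z) ^ 2)
          = sqrt (fst z ^ 2 + snd z ^ 2)).
  rewrite !pow2_abs; reflexivity.
Qed.

Lemma Cmod_CInt_le (f : R -> C) (h : R -> R) (a b : R) (I : C) (J : R) :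
  a <= b -> (forall t, a <= t <= b -> Cmod (f t) <= h t) ->
  is_CInt f a b I -> is_RInt h a b J -> Cmod I <= J.
Proof.
  intros Hab Hf HI HJ; rewrite <- Cmod_norm_R.
  apply (norm_RInt_le (V := C_R_NormedModule) f h a b I J Hab); try assumption.
  intros t Ht; rewrite Cmod_norm_R; apply Hf; assumption.
Qed.

Lemma Cmod_CInt_le_const (f : R -> C) (B a b : R) (I : C) :
  a <= b -> (forall t, a <= t <= b -> Cmod (f t) <= B) ->
  is_CInt f a b I -> Cmod I <= (b - a) * B.
Proof.
  intros Hab Hf HI; rewrite <- Cmod_norm_R.
  apply (norm_RInt_le_const (V := C_R_NormedModule) f a b I B Hab); auto.
  intros t Ht; rewrite Cmod_norm_R; apply Hf; assumption.
Qed.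

Lemma is_CInt_Re_pos (f : R -> C) :
  (forall t, 0 <= t <= 1 -> continuous f t) ->
  (forall t, 0 <= t <= 1 -> 0 < Re (f t)) -> ~ is_CInt f 0 1 0.
Proof.
  intros Hc Hpos HI; apply is_CInt_parts in HI; destruct HI as [HI _].
  apply (is_RInt_unique (V := R_CompleteNormedModule)) in HI.
  assert (H : 0 < RInt (fun t => Re (f t)) 0 1).
  { apply RInt_gt_0; [lra| |]; intros t Ht.
    - apply Hpos; lra.
    - apply continuous_Re, Hc; lra. }
  rewrite HI in H; simpl in H; lra.
Qed.

Lemma is_CInt_Re_nonneg (f : R -> C) :
  (forall t, 0 <= t <= 1 -> continuous f t) ->
  (forall t, 0 <= t <= 1 -> 0 <= Re (f t)) -> is_CInt f 0 1 0 ->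
  forall t, 0 < t < 1 -> Re (f t) = 0.
Proof.
  intros Hc Hpos HI t Ht; apply is_CInt_parts in HI; destruct HI as [HI _].
  destruct (Hpos t ltac:(lra)) as [Hgt|]; [exfalso|auto].
  set (g := fun t => Re (f t)) in *.
  assert (Hgc : forall t, 0 <= t <= 1 -> continuous g t)
    by (intros s Hs; apply continuous_Re; auto).
  destruct (Hgc t ltac:(lra) (fun y => 0 < y) (open_gt 0 _ Hgt)) as [del Hdel].
  set (u := Rmin ((t + 1) / 2) (t + del / 2)).
  assert (Hd := cond_pos del).
  assert (Hu : t < u < 1 /\ u < t + del).
  { unfold u; generalize (Rmin_l ((t + 1) / 2) (t + del / 2))
      (Rmin_r ((t + 1) / 2) (t + del / 2)).
    assert (t < Rmin ((t + 1) / 2) (t + del / 2)) by (apply Rmin_glb_lt; lra).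
    lra. }
  assert (Hex : forall a b, 0 <= a -> a <= b -> b <= 1 ->
            is_RInt g a b (RInt g a b)).
  { intros a b Ha Hab Hb; apply (RInt_correct (V := R_CompleteNormedModule)).
    apply (ex_RInt_continuous (V := R_CompleteNormedModule)).
    rewrite Rmin_left, Rmax_right by assumption; intros s Hs; apply Hgc; lra. }
  assert (H1 : 0 <= RInt g 0 t).
  { apply (is_RInt_ge_0 g 0 t); [lra|apply Hex; lra|]; intros s Hs; apply Hpos; lra. }
  assert (H2 : 0 < RInt g t u).
  { apply RInt_gt_0; [lra| |]; intros s Hs; [|apply Hgc; lra].
    apply Hdel; change (Rabs (s - t) < del); rewrite Rabs_pos_eq; lra. }
  assert (H3 : 0 <= RInt g u 1).
  { apply (is_RInt_ge_0 g u 1); [lra|apply Hex; lra|]; intros s Hs; apply Hpos; lra. }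
  assert (Htot := is_RInt_Chasles (V := R_NormedModule) g 0 u 1 _ _
    (is_RInt_Chasles (V := R_NormedModule) g 0 t u _ _
      (Hex 0 t ltac:(lra) ltac:(lra) ltac:(lra))
      (Hex t u ltac:(lra) ltac:(lra) ltac:(lra)))
    (Hex u 1 ltac:(lra) ltac:(lra) ltac:(lra))).
  apply (is_RInt_unique (V := R_CompleteNormedModule)) in Htot.
  apply (is_RInt_unique (V := R_CompleteNormedModule)) in HI.
  rewrite HI in Htot; unfold plus in Htot; simpl in Htot; lra.
Qed.

(** Componentwise, so that the calculus of real functions applies. *)
Definition curve_derive (gam : R -> C) (t : R) (d : C) : Prop :=
  is_derive (fun x => Re (gam x)) t (Re d) /\
  is_derive (fun x => Im (gam x)) t (Im d).

Lemma curve_derive_continuous (gam : R -> C) (t : R) (d : C) :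
  curve_derive gam t d -> continuous gam t.
Proof.
  intros [H1 H2].
  apply continuous_ext with (fun t => (Re (gam t), Im (gam t)) : C).
  - intros x; symmetry; apply surjective_pairing.
  - apply continuous_pair;
      apply (ex_derive_continuous (V := R_NormedModule));
      eexists; eassumption.
Qed.

Lemma is_CInt_derive (gam d : R -> C) (a b : R) :
  a <= b ->
  (forall t, a <= t <= b -> curve_derive gam t (d t)) ->
  (forall t, a <= t <= b -> continuous d t) ->
  is_CInt d a b (gam b - gam a)%C.
Proof.
  intros Hab Hd Hc; apply is_CInt_parts; split.
  - apply (is_RInt_derive (V := R_CompleteNormedModule) (fun t => Re (gam t)));
      rewrite Rmin_left, Rmax_right by assumption; intros t Ht.
    + apply Hd; assumption.
    + apply continuous_Re, Hc; assumption.
  - apply (is_RInt_derive (V := R_CompleteNormedModule) (fun t => Im (gam t)));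
      rewrite Rmin_left, Rmax_right by assumption; intros t Ht.
    + apply Hd; assumption.
    + apply continuous_Im, Hc; assumption.
Qed.

Lemma curve_derive_const (c : C) (t : R) : curve_derive (fun _ => c) t 0.
Proof. split; apply (is_derive_const (V := R_NormedModule)). Qed.

Lemma curve_derive_plus (f g : R -> C) (t : R) (d e : C) :
  curve_derive f t d -> curve_derive g t e ->
  curve_derive (fun x => (f x + g x)%C) t (d + e)%C.
Proof.
  intros [H1 H2] [H3 H4]; split;
    apply (is_derive_plus (V := R_NormedModule)); assumption.
Qed.

Lemma curve_derive_mult (f g : R -> C) (t : R) (d e : C) :
  curve_derive f t d -> curve_derive g t e ->
  curve_derive (fun x => (f x * g x)%C) t (d * g t + f t * e)%C.
Proof.
  intros [H1 H2] [H3 H4].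
  assert (S := fun u v du dv Hu Hv =>
    is_derive_mult (K := R_AbsRing) u v t du dv Hu Hv Rmult_comm).
  split.
  - replace (Re (d * g t + f t * e)%C) with
      ((Re d * Re (g t) + Re (f t) * Re e)
       - (Im d * Im (g t) + Im (f t) * Im e)) by (simpl; unfold Re, Im; ring).
    exact (is_derive_minus (V := R_NormedModule) _ _ _ _ _
             (S _ _ _ _ H1 H3) (S _ _ _ _ H2 H4)).
  - replace (Im (d * g t + f t * e)%C) with
      ((Re d * Im (g t) + Re (f t) * Im e)
       + (Im d * Re (g t) + Im (f t) * Re e)) by (simpl; unfold Re, Im; ring).
    exact (is_derive_plus (V := R_NormedModule) _ _ _ _ _
             (S _ _ _ _ H1 H4) (S _ _ _ _ H2 H3)).
Qed.

(** * Goursat's theorem for parametrised squares *)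

(** The reference point [(u, v)] of a small square lies in the square.  The
    covering of the unit square by neighbourhoods would only give reference
    points at a distance that the size of the square does not control, and the
    error of a first-order expansion there would be too large. *)
Lemma square_bisection (P : R -> R -> R -> Prop) :
  (forall x y h, 0 <= x -> 0 <= y -> 0 < h -> x + 2 * h <= 1 ->
     y + 2 * h <= 1 ->
     P x y h -> P (x + h) y h -> P x (y + h) h -> P (x + h) (y + h) h ->
     P x y (2 * h)) ->
  (forall u v, 0 <= u <= 1 -> 0 <= v <= 1 ->
     exists del, 0 < del /\
       forall x y h, 0 < h < del -> 0 <= x <= u -> u <= x + h <= 1 ->
         0 <= y <= v -> v <= y + h <= 1 -> P x y h) ->
  P 0 0 1.
Proof.
  intros Hglue Hloc; apply NNPP; intros Hnot.
  pose (dec := fun x y h => excluded_middle_informative (P x y h)).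
  pose (next := fun (q : R * R) (h : R) =>
    let (x, y) := q in
    if dec x y h then
      if dec (x + h) y h then
        if dec x (y + h) h then (x + h, y + h) else (x, y + h)
      else (x + h, y)
    else (x, y)).
  pose (sz := fun n => (/ 2) ^ n).
  pose (q := fix q (n : nat) : R * R :=
    match n with O => (0, 0) | S m => next (q m) (sz (S m)) end).
  assert (Hsz : forall n, 0 < sz n /\ sz n = 2 * sz (S n)).
  { intros n; split; [apply pow_lt; lra | unfold sz; simpl; lra]. }
  assert (Hstep : forall n,
    (fst (q n) <= fst (q (S n)) /\
     fst (q (S n)) + sz (S n) <= fst (q n) + sz n) /\
    (snd (q n) <= snd (q (S n)) /\
     snd (q (S n)) + sz (S n) <= snd (q n) + sz n)).
  { intros n; destruct (Hsz n) as [_ H1]; destruct (Hsz (S n)) as [H2 _].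
    change (q (S n)) with (next (q n) (sz (S n))).
    destruct (q n) as [x y]; unfold next.
    destruct (dec x y (sz (S n))), (dec (x + sz (S n)) y (sz (S n))),
      (dec x (y + sz (S n)) (sz (S n))); simpl fst; simpl snd; lra. }
  assert (Hmono : forall n p,
    (fst (q n) <= fst (q (p + n)%nat) /\
     fst (q (p + n)%nat) + sz (p + n)%nat <= fst (q n) + sz n) /\
    (snd (q n) <= snd (q (p + n)%nat) /\
     snd (q (p + n)%nat) + sz (p + n)%nat <= snd (q n) + sz n)).
  { intros n p; induction p as [|p IH]; [simpl; lra|].
    change (S p + n)%nat with (S (p + n)).
    generalize (Hstep (p + n)%nat); lra. }
  assert (Hin : forall n, (0 <= fst (q n) /\ fst (q n) + sz n <= 1) /\
                          (0 <= snd (q n) /\ snd (q n) + sz n <= 1)).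
  { intros n; generalize (Hmono O n); rewrite <- plus_n_O.
    unfold sz at 2 4; simpl; lra. }
  assert (Hbad : forall n, ~ P (fst (q n)) (snd (q n)) (sz n)).
  { intros n; induction n as [|n IH]; [exact Hnot|].
    intros HP; apply IH; clear IH.
    destruct (Hsz n) as [_ H1]; destruct (Hsz (S n)) as [H2 _].
    generalize (Hin n); rewrite H1.
    change (q (S n)) with (next (q n) (sz (S n))) in HP.
    destruct (q n) as [x y]; unfold next in HP; simpl fst; simpl snd.
    intros HI.
    destruct (dec x y (sz (S n))), (dec (x + sz (S n)) y (sz (S n))),
      (dec x (y + sz (S n)) (sz (S n))); simpl in HP; try contradiction.
    apply Hglue; try assumption; lra. }
  assert (Hnest : forall c : nat -> R,
    (forall n p, c n <= c (p + n)%nat /\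
       c (p + n)%nat + sz (p + n)%nat <= c n + sz n) ->
    exists u, forall n, c n <= u <= c n + sz n).
  { intros c Hc.
    assert (Hub : forall n m, c n <= c m + sz m).
    { intros n m; generalize (Hc n m) (Hc m n); rewrite (Nat.add_comm m n).
      generalize (proj1 (Hsz (n + m)%nat)); lra. }
    destruct (completeness (fun r => exists n, r = c n)) as [u [Hu1 Hu2]].
    - exists (c O + sz O); intros r [n ->]; apply Hub.
    - exists (c O), O; reflexivity.
    - exists u; intros n; split.
      + apply Hu1; exists n; reflexivity.
      + apply Hu2; intros r [m ->]; apply Hub. }
  destruct (Hnest (fun n => fst (q n))) as [u Hu];
    [intros n p; apply (Hmono n p)|].
  destruct (Hnest (fun n => snd (q n))) as [v Hv];
    [intros n p; apply (Hmono n p)|].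
  assert (Hu1 : 0 <= u <= 1) by (generalize (Hu O) (Hin O); simpl; lra).
  assert (Hv1 : 0 <= v <= 1) by (generalize (Hv O) (Hin O); simpl; lra).
  destruct (Hloc u v Hu1 Hv1) as [del [Hdel HP]].
  destruct (pow_lt_1_zero (/ 2) ltac:(rewrite Rabs_pos_eq; lra) del Hdel)
    as [n Hn].
  specialize (Hn n (le_n n)); apply (Hbad n).
  generalize (Hu n) (Hv n) (Hin n) (Hsz n); intros Hun Hvn Hinn [Hszn _].
  apply HP; try lra.
  split; [assumption|]; unfold sz in *; rewrite Rabs_pos_eq in Hn; lra.
Qed.

(** The affine part of [g] at [z0] has the primitive
    [g z0 * z + l / 2 * (z - z0)^2], so only the remainder of the first-order
    expansion contributes, up to the values of this primitive at the ends. *)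
Lemma curve_integral_affine_approx (g : C -> C) (z0 l : C) (gam d : R -> C)
    (a b B : R) :
  a <= b ->
  (forall t, a <= t <= b -> curve_derive gam t (d t)) ->
  (forall t, a <= t <= b -> continuous d t) ->
  (forall t, a <= t <= b -> continuous g (gam t)) ->
  (forall t, a <= t <= b ->
     Cmod ((g (gam t) - (g z0 + l * (gam t - z0))) * d t) <= B) ->
  let L := fun z : C => (g z0 * z + l / 2 * ((z - z0) * (z - z0)))%C in
  Cmod (CInt (fun t => (g (gam t) * d t)%C) a b - (L (gam b) - L (gam a)))
    <= (b - a) * B.
Proof.
  intros Hab Hd Hdc Hg HB L.
  assert (Hgam : forall t, a <= t <= b -> continuous gam t).
  { intros t Ht; apply curve_derive_continuous with (d t); auto. }
  assert (Hsh : forall t, a <= t <= b ->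
    continuous (fun t => (gam t - z0)%C) t).
  { intros t Ht; apply continuous_Cplus; [auto | apply continuous_const]. }
  assert (HL : is_CInt (fun t => ((g z0 + l * (gam t - z0)) * d t)%C) a b
                 (L (gam b) - L (gam a))%C).
  { apply (is_CInt_derive (fun t => L (gam t))); try assumption.
    - intros t Ht; unfold L.
      replace ((g z0 + l * (gam t - z0)) * d t)%C with
        ((0 * gam t + g z0 * d t) +
         (0 * ((gam t - z0) * (gam t - z0)) +
          l / 2 * ((d t + 0) * (gam t - z0) + (gam t - z0) * (d t + 0))))%C
        by (field; intros E; apply (f_equal Re) in E; simpl in E; lra).
      apply curve_derive_plus; apply curve_derive_mult;
        try apply curve_derive_const; auto.
      apply (curve_derive_mult (fun t => gam t - z0)%C (fun t => gam t - z0)%C);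
        apply curve_derive_plus; try apply curve_derive_const; auto.
    - intros t Ht; apply continuous_Cmult; auto.
      apply continuous_Cplus; [apply continuous_const|].
      apply continuous_Cmult; [apply continuous_const|auto]. }
  apply Cmod_CInt_le_const with
    (fun t => (g (gam t) * d t - (g z0 + l * (gam t - z0)) * d t)%C);
    try assumption.
  - intros t Ht; replace (g (gam t) * d t - (g z0 + l * (gam t - z0)) * d t)%C
      with ((g (gam t) - (g z0 + l * (gam t - z0))) * d t)%C by ring; auto.
  - apply is_CInt_minus; [|assumption].
    apply is_CInt_CInt; [assumption|]; intros t Ht.
    apply continuous_Cmult; auto.
    apply continuous_comp; auto.
Qed.

(** The integral of [g dz] along the image under [Phi] of the boundary of
    [[x, x + h] * [y, y + h]], counterclockwise. *)
Definition square_integral (g : C -> C) (Phi Phis Phit : R -> R -> C)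
    (x y h : R) : C :=
  (CInt (fun s => (g (Phi s y) * Phis s y)%C) x (x + h)
   + CInt (fun t => (g (Phi (x + h)%R t) * Phit (x + h)%R t)%C) y (y + h)
   - CInt (fun s => (g (Phi s (y + h)%R) * Phis s (y + h)%R)%C) x (x + h)
   - CInt (fun t => (g (Phi x t) * Phit x t)%C) y (y + h))%C.

Lemma Cmod_sum4_le (x y z w : C) :
  Cmod (x + y + z + w) <= Cmod x + Cmod y + Cmod z + Cmod w.
Proof.
  eapply Rle_trans; [apply Cmod_triangle|]; apply Rplus_le_compat_r.
  eapply Rle_trans; [apply Cmod_triangle|]; apply Rplus_le_compat_r.
  apply Cmod_triangle.
Qed.

Section Goursat.

Variables (g : C -> C) (Phi Phis Phit : R -> R -> C) (M : R).
Hypothesis HPhis : forall s t, 0 <= s <= 1 -> 0 <= t <= 1 ->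
  curve_derive (fun s => Phi s t) s (Phis s t).
Hypothesis HPhit : forall s t, 0 <= s <= 1 -> 0 <= t <= 1 ->
  curve_derive (Phi s) t (Phit s t).
Hypothesis HPhisc : forall s t, 0 <= s <= 1 -> 0 <= t <= 1 ->
  continuous (fun s => Phis s t) s.
Hypothesis HPhitc : forall s t, 0 <= s <= 1 -> 0 <= t <= 1 ->
  continuous (Phit s) t.
Hypothesis HMs : forall s t, 0 <= s <= 1 -> 0 <= t <= 1 -> Cmod (Phis s t) <= M.
Hypothesis HMt : forall s t, 0 <= s <= 1 -> 0 <= t <= 1 -> Cmod (Phit s t) <= M.
Hypothesis Hg : forall s t, 0 <= s <= 1 -> 0 <= t <= 1 -> Cdiff g (Phi s t).

Let J := square_integral g Phi Phis Phit.

Lemma continuous_edge_s s t : 0 <= s <= 1 -> 0 <= t <= 1 ->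
  continuous (fun s => (g (Phi s t) * Phis s t)%C) s.
Proof.
  intros Hs Ht; apply continuous_Cmult; [|auto].
  apply continuous_comp.
  - apply curve_derive_continuous with (Phis s t); auto.
  - apply Cdiff_continuous; auto.
Qed.

Lemma continuous_edge_t s t : 0 <= s <= 1 -> 0 <= t <= 1 ->
  continuous (fun t => (g (Phi s t) * Phit s t)%C) t.
Proof.
  intros Hs Ht; apply continuous_Cmult; [|auto].
  apply continuous_comp.
  - apply curve_derive_continuous with (Phit s t); auto.
  - apply Cdiff_continuous; auto.
Qed.

Lemma square_integral_split x y h :
  0 <= x -> 0 <= y -> 0 < h -> x + 2 * h <= 1 -> y + 2 * h <= 1 ->
  J x y (2 * h)
  = (J x y h + J (x + h)%R y h + J x (y + h)%R h + J (x + h)%R (y + h)%R h)%C.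
Proof.
  intros Hx Hy Hh Hx1 Hy1; unfold J, square_integral.
  replace (x + 2 * h) with (x + h + h) by ring.
  replace (y + 2 * h) with (y + h + h) by ring.
  assert (Hs : forall t, 0 <= t <= 1 ->
    CInt (fun s => (g (Phi s t) * Phis s t)%C) x (x + h + h)
    = (CInt (fun s => (g (Phi s t) * Phis s t)%C) x (x + h)
       + CInt (fun s => (g (Phi s t) * Phis s t)%C) (x + h) (x + h + h))%C).
  { intros t Ht; apply CInt_Chasles; [lra|lra|]; intros s Hs.
    apply continuous_edge_s; lra. }
  assert (Ht : forall s, 0 <= s <= 1 ->
    CInt (fun t => (g (Phi s t) * Phit s t)%C) y (y + h + h)
    = (CInt (fun t => (g (Phi s t) * Phit s t)%C) y (y + h)
       + CInt (fun t => (g (Phi s t) * Phit s t)%C) (y + h) (y + h + h))%C).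
  { intros s Hs'; apply CInt_Chasles; [lra|lra|]; intros t Ht.
    apply continuous_edge_t; lra. }
  rewrite (Hs y), (Hs (y + h + h)), (Ht x), (Ht (x + h + h)) by lra.
  ring.
Qed.

Lemma Phi_lipschitz s t u v :
  0 <= s <= 1 -> 0 <= t <= 1 -> 0 <= u <= 1 -> 0 <= v <= 1 ->
  Cmod (Phi s t - Phi u v) <= M * (Rabs (s - u) + Rabs (t - v)).
Proof.
  intros Hs Ht Hu Hv.
  assert (H1 : forall a b, 0 <= a -> a <= b -> b <= 1 ->
            Cmod (Phi b t - Phi a t) <= (b - a) * M).
  { intros a b Ha Hab Hb.
    apply Cmod_CInt_le_const with (fun s => Phis s t); try assumption.
    - intros r Hr; apply HMs; lra.
    - apply (is_CInt_derive (fun s => Phi s t)); try assumption; intros r Hr;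
        [apply HPhis | apply HPhisc]; lra. }
  assert (H2 : forall a b, 0 <= a -> a <= b -> b <= 1 ->
            Cmod (Phi u b - Phi u a) <= (b - a) * M).
  { intros a b Ha Hab Hb.
    apply Cmod_CInt_le_const with (Phit u); try assumption.
    - intros r Hr; apply HMt; lra.
    - apply is_CInt_derive; try assumption; intros r Hr;
        [apply HPhit | apply HPhitc]; lra. }
  replace (Phi s t - Phi u v)%C
    with ((Phi s t - Phi u t) + (Phi u t - Phi u v))%C by ring.
  eapply Rle_trans; [apply Cmod_triangle|].
  rewrite Rmult_plus_distr_l; apply Rplus_le_compat.
  - destruct (Rle_dec u s).
    + rewrite Rabs_pos_eq by lra; rewrite Rmult_comm; apply H1; lra.
    + rewrite Rabs_left by lra.
      replace (Phi s t - Phi u t)%C with (- (Phi u t - Phi s t))%C by ring.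
      rewrite Cmod_opp; generalize (H1 s u); lra.
  - destruct (Rle_dec v t).
    + rewrite Rabs_pos_eq by lra; rewrite Rmult_comm; apply H2; lra.
    + rewrite Rabs_left by lra.
      replace (Phi u t - Phi u v)%C with (- (Phi u v - Phi u t))%C by ring.
      rewrite Cmod_opp; generalize (H2 t v); lra.
Qed.

(** The values of the primitive of the affine part of [g] at the corners cancel.
    On each of the four sides, of length [h], the remainder is at most
    [eta * (2 * M * h)] and the speed at most [M]. *)
Lemma square_integral_local eps u v :
  0 < eps -> 0 <= u <= 1 -> 0 <= v <= 1 ->
  exists del, 0 < del /\
    forall x y h, 0 < h < del -> 0 <= x <= u -> u <= x + h <= 1 ->
      0 <= y <= v -> v <= y + h <= 1 -> Cmod (J x y h) <= eps * (h * h).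
Proof.
  intros Heps Hu Hv.
  assert (HM : 0 <= M).
  { apply Rle_trans with (Cmod (Phis u v)); [apply Cmod_ge_0 | auto]. }
  destruct (Hg u v Hu Hv) as [l [phi [Hc [El Hphi]]]].
  assert (Heta : 0 < eps / (8 * M * M + 1))
    by (apply Rdiv_lt_0_compat; nra).
  set (eta := eps / (8 * M * M + 1)) in *.
  destruct (proj1 (continuous_C_iff _ _) Hc eta Heta) as [r [Hr Hphir]].
  exists (r / (2 * M + 1)); split; [apply Rdiv_lt_0_compat; lra|].
  intros x y h [Hh0 Hh] Hx Hx1 Hy Hy1.
  assert (Hhr : M * (2 * h) < r).
  { apply Rmult_lt_compat_r with (r := 2 * M + 1) in Hh; [|lra].
    unfold Rdiv in Hh; rewrite Rmult_assoc, Rinv_l in Hh by lra; nra. }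
  assert (Hrem : forall s t d, x <= s <= x + h -> y <= t <= y + h ->
    Cmod d <= M ->
    Cmod ((g (Phi s t) - (g (Phi u v) + l * (Phi s t - Phi u v))) * d)
      <= eta * (M * (2 * h)) * M).
  { intros s t d Hs Ht Hd.
    assert (Hdist : Cmod (Phi s t - Phi u v) <= M * (2 * h)).
    { eapply Rle_trans; [apply Phi_lipschitz; lra|].
      apply Rmult_le_compat_l; [assumption|].
      assert (Rabs (s - u) <= h) by (apply Rabs_le; lra).
      assert (Rabs (t - v) <= h) by (apply Rabs_le; lra).
      lra. }
    replace (g (Phi s t) - (g (Phi u v) + l * (Phi s t - Phi u v)))%C
      with ((phi (Phi s t) - phi (Phi u v)) * (Phi s t - Phi u v))%C
      by (rewrite (Hphi (Phi s t)), El; ring).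
    rewrite !Cmod_mult.
    apply Rmult_le_compat; try assumption; try apply Cmod_ge_0.
    - apply Rmult_le_pos; apply Cmod_ge_0.
    - apply Rmult_le_compat; try assumption; try apply Cmod_ge_0.
      left; apply Hphir; lra. }
  pose (L := fun z : C => (g (Phi u v) * z
               + l / 2 * ((z - Phi u v) * (z - Phi u v)))%C).
  set (B := eta * (M * (2 * h)) * M) in *.
  assert (Hs : forall t, y <= t <= y + h ->
    Cmod (CInt (fun s => (g (Phi s t) * Phis s t)%C) x (x + h)
          - (L (Phi (x + h)%R t) - L (Phi x t))) <= h * B).
  { intros t Ht; replace h with (x + h - x) at 3 by ring.
    apply (curve_integral_affine_approx g (Phi u v) l (fun s => Phi s t)
             (fun s => Phis s t)); [lra|..]; intros s Hs.
    - apply HPhis; lra.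
    - apply HPhisc; lra.
    - apply Cdiff_continuous, Hg; lra.
    - apply Hrem; try lra; apply HMs; lra. }
  assert (Ht : forall s, x <= s <= x + h ->
    Cmod (CInt (fun t => (g (Phi s t) * Phit s t)%C) y (y + h)
          - (L (Phi s (y + h)%R) - L (Phi s y))) <= h * B).
  { intros s Hs'; replace h with (y + h - y) at 3 by ring.
    apply (curve_integral_affine_approx g (Phi u v) l (Phi s) (Phit s));
      [lra|..]; intros t Ht.
    - apply HPhit; lra.
    - apply HPhitc; lra.
    - apply Cdiff_continuous, Hg; lra.
    - apply Hrem; try lra; apply HMt; lra. }
  assert (H1 := Hs y ltac:(lra)); assert (H2 := Ht (x + h) ltac:(lra)).
  assert (H3 := Hs (y + h) ltac:(lra)); assert (H4 := Ht x ltac:(lra)).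
  unfold J, square_integral.
  revert H1 H2 H3 H4.
  generalize (CInt (fun s => (g (Phi s y) * Phis s y)%C) x (x + h)),
    (CInt (fun t => (g (Phi (x + h)%R t) * Phit (x + h)%R t)%C) y (y + h)),
    (CInt (fun s => (g (Phi s (y + h)%R) * Phis s (y + h)%R)%C) x (x + h)),
    (CInt (fun t => (g (Phi x t) * Phit x t)%C) y (y + h)).
  generalize (L (Phi x y)), (L (Phi (x + h)%R y)), (L (Phi x (y + h)%R)),
    (L (Phi (x + h)%R (y + h)%R)).
  intros L1 L2 L3 L4 I1 I2 I3 I4 H1 H2 H3 H4.
  replace (I1 + I2 - I3 - I4)%C with
    ((I1 - (L2 - L1)) + (I2 - (L4 - L2)) + - (I3 - (L4 - L3))
     + - (I4 - (L3 - L1)))%C by ring.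
  apply Rle_trans with (4 * (h * B)).
  - eapply Rle_trans; [apply Cmod_sum4_le|].
    rewrite !Cmod_opp; lra.
  - unfold B; replace (4 * (h * (eta * (M * (2 * h)) * M)))
      with (eta * (8 * M * M) * (h * h)) by ring.
    apply Rmult_le_compat_r; [nra|].
    apply Rle_trans with (eta * (8 * M * M + 1)).
    + apply Rmult_le_compat_l; lra.
    + unfold eta; right; field; nra.
Qed.

(** The bound [eps * h^2] passes from the quarters of a square to the square, as
    it is proportional to the area. *)
Theorem goursat_square : J 0 0 1 = 0.
Proof.
  apply Cmod_eq_0.
  assert (H : forall eps, 0 < eps -> Cmod (J 0 0 1) <= eps * (1 * 1)).
  { intros eps Heps.
    apply (square_bisection (fun x y h => Cmod (J x y h) <= eps * (h * h))).
    - intros x y h Hx Hy Hh Hx1 Hy1 H1 H2 H3 H4.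
      rewrite square_integral_split by assumption.
      eapply Rle_trans; [apply Cmod_sum4_le|].
      lra.
    - intros u v Hu Hv; apply square_integral_local; assumption. }
  destruct (Rle_lt_or_eq_dec 0 _ (Cmod_ge_0 (J 0 0 1))) as [Hpos|Heq]; [|auto].
  specialize (H (Cmod (J 0 0 1) / 2)); lra.
Qed.

End Goursat.

(** * Integrals over the unit circle *)

Definition circ (t : R) : C := (cos (2 * PI * t), sin (2 * PI * t)).

Lemma Cmod_circ t : Cmod (circ t) = 1.
Proof.
  unfold Cmod, circ; simpl.
  replace (_ + _) with 1; [apply sqrt_1|].
  generalize (sin2_cos2 (2 * PI * t)); unfold Rsqr; lra.
Qed.

Lemma circ_nz t : circ t <> 0.
Proof. apply Cmod_gt_0; rewrite Cmod_circ; lra. Qed.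

Lemma Cconj_circ t : Cconj (circ t) = (/ circ t)%C.
Proof.
  assert (E := Cmod2_conj (circ t)); rewrite Cmod_circ in E.
  replace (1 ^ 2) with 1 in E by ring.
  replace (/ circ t)%C with (circ t * Cconj (circ t) * / circ t)%C
    by (rewrite <- E; ring).
  field; apply circ_nz.
Qed.

Lemma circ_0 : circ 0 = 1.
Proof. unfold circ; rewrite Rmult_0_r, cos_0, sin_0; reflexivity. Qed.

Lemma circ_1 : circ 1 = 1.
Proof. unfold circ; rewrite Rmult_1_r, cos_2PI, sin_2PI; reflexivity. Qed.

Lemma curve_derive_circ t : curve_derive circ t (RtoC (2 * PI) * Ci * circ t)%C.
Proof.
  split; unfold circ; simpl; auto_derive; trivial; simpl; ring.
Qed.

Lemma continuous_circ t : continuous circ t.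
Proof. eapply curve_derive_continuous, curve_derive_circ. Qed.

Lemma circ_half_turn (t : R) : circ (t + / 2) = (- circ t)%C.
Proof.
  unfold circ; replace (2 * PI * (t + / 2)) with (2 * PI * t + PI) by field.
  rewrite neg_cos, neg_sin; reflexivity.
Qed.

Lemma circ_neq_interior p t : Cmod p < 1 -> 1 - Cmod p <= Cmod (circ t - p).
Proof.
  intros Hp; generalize (Cmod_triangle (circ t - p) p).
  replace (circ t - p + p)%C with (circ t) by ring.
  rewrite Cmod_circ; lra.
Qed.

(** The dilations of the circle towards [p] parametrise a square on which
    Goursat's theorem applies to [H z / (z - p)^(m+1)]; the two radial sides
    cancel, and the integral over the small circle tends to [0]. *)
Theorem circle_integral_vanishing (H : C -> C) (p : C) (m : nat) :
  (forall z, Cmod z <= 1 -> Cdiff H z) -> Cmod p < 1 ->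
  (forall eta, 0 < eta -> exists del, 0 < del /\
     forall w, Cmod (w - p) < del -> Cmod (H w) <= eta * Cmod (w - p) ^ m) ->
  is_CInt (fun t => (circ t * H (circ t) / (circ t - p) ^ S m)%C) 0 1 0.
Proof.
  intros HH Hp Hord.
  set (g := fun w : C => (H w / (w - p) ^ S m)%C).
  assert (Hgap := fun t => circ_neq_interior p t Hp).
  assert (Hcp : forall t, (circ t - p)%C <> 0).
  { intros t; apply Cmod_neq_0; generalize (Hgap t); lra. }
  assert (Hcp2 : forall t, Cmod (circ t - p) <= 2).
  { intros t; unfold Cminus; eapply Rle_trans; [apply Cmod_triangle|].
    rewrite Cmod_opp, Cmod_circ; lra. }
  assert (Hg : forall z, Cmod z <= 1 -> z <> p -> Cdiff g z).
  { intros z Hz Hzp; apply Cdiff_div; [auto| |].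
    - apply Cdiff_pow with (f := fun w => (w - p)%C).
      apply Cdiff_minus; [apply Cdiff_id | apply Cdiff_const].
    - apply Cpow_nz; intros E; apply Hzp.
      replace z with (z - p + p)%C by ring; rewrite E; ring. }
  set (X := CInt (fun t => (circ t * H (circ t) / (circ t - p) ^ S m)%C) 0 1).
  assert (HX : is_CInt (fun t => (circ t * H (circ t) / (circ t - p) ^ S m)%C)
                 0 1 X).
  { apply is_CInt_CInt; [lra|]; intros t _.
    apply continuous_Cmult; [apply continuous_Cmult|].
    - apply continuous_circ.
    - apply continuous_comp; [apply continuous_circ|].
      apply Cdiff_continuous, HH; rewrite Cmod_circ; lra.
    - apply continuous_Cinv; [|apply Cpow_nz; auto].
      apply (continuous_Cpow _ (fun t => circ t - p)%C).
      apply continuous_Cplus; [apply continuous_circ | apply continuous_const]. }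
  replace (RtoC 0) with X; [exact HX|]; clearbody X.
  set (tau := (RtoC (2 * PI) * Ci)%C).
  assert (HPI := PI_RGT_0).
  assert (Htau : Cmod tau = 2 * PI).
  { unfold tau; rewrite Cmod_mult, Cmod_R, Cmod_Ci, Rabs_pos_eq; lra. }
  assert (Hsmall : forall eta, 0 < eta ->
            Cmod (tau * X) <= 8 * eta / (1 - Cmod p)).
  { intros eta Heta; destruct (Hord eta Heta) as [del [Hdel Hw]].
    (* the smallest circle has its points at distance at most [2 * e < del]
       from [p] *)
    set (e := Rmin (1 / 2) (del / 4)).
    assert (He : 0 < e <= 1 / 2 /\ 2 * e < del).
    { unfold e; generalize (Rmin_l (1 / 2) (del / 4)) (Rmin_r (1 / 2) (del / 4)).
      assert (0 < Rmin (1 / 2) (del / 4)) by (apply Rmin_pos; lra); lra. }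
    clearbody e.
    set (rho := fun s => e + (1 - e) * s).
    assert (Hrho : forall s, 0 <= s <= 1 -> 0 < rho s <= 1)
      by (intros s Hs; unfold rho; nra).
    set (Phi := fun s t => (p + RtoC (rho s) * (circ t - p))%C).
    set (Phis := fun (s t : R) => (RtoC (1 - e) * (circ t - p))%C).
    set (Phit := fun s t => (RtoC (rho s) * (tau * circ t))%C).
    assert (Hin : forall s t, 0 <= s <= 1 -> Cmod (Phi s t) <= 1).
    { intros s t Hs; specialize (Hrho s Hs); unfold Phi.
      replace (p + RtoC (rho s) * (circ t - p))%C
        with (RtoC (1 - rho s) * p + RtoC (rho s) * circ t)%C
        by (rewrite RtoC_minus; ring).
      eapply Rle_trans; [apply Cmod_triangle|].
      rewrite !Cmod_mult, !Cmod_R, Cmod_circ, !Rabs_pos_eq by lra.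
      nra. }
    assert (Hne : forall s t, 0 <= s <= 1 -> Phi s t <> p).
    { intros s t Hs E; specialize (Hrho s Hs).
      assert (E' : (RtoC (rho s) * (circ t - p))%C = 0).
      { replace (RtoC (rho s) * (circ t - p))%C with (Phi s t - p)%C
          by (unfold Phi; ring); rewrite E; ring. }
      revert E'; apply Cmult_neq_0; [|apply Hcp].
      intros E'; apply RtoC_inj in E'; lra. }
    assert (G : square_integral g Phi Phis Phit 0 0 1 = 0).
    { (* [8] bounds both [2] and [2 * PI], since [PI <= 4] *)
      apply goursat_square with 8.
      - intros s t Hs Ht; unfold Phi, Phis.
        replace (RtoC (1 - e) * (circ t - p))%C
          with (0 + (RtoC (1 - e) * (circ t - p) + RtoC (rho s) * 0))%C by ring.
        apply curve_derive_plus; [apply curve_derive_const|].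
        apply (curve_derive_mult (fun s => RtoC (rho s)) (fun _ => circ t - p)%C);
          [|apply curve_derive_const].
        split; simpl; unfold rho; auto_derive; trivial; ring.
      - intros s t Hs Ht; unfold Phi, Phit.
        replace (RtoC (rho s) * (tau * circ t))%C
          with (0 + (0 * (circ t - p) + RtoC (rho s) * (tau * circ t + 0)))%C
          by ring.
        apply curve_derive_plus; [apply curve_derive_const|].
        apply (curve_derive_mult (fun _ => RtoC (rho s)) (fun t => circ t - p)%C);
          [apply curve_derive_const|].
        apply curve_derive_plus; [apply curve_derive_circ|].
        apply (curve_derive_const (- p)%C).
      - intros s t _ _; apply continuous_const.
      - intros s t _ _; unfold Phit.
        apply continuous_Cmult; [apply continuous_const|].
        apply continuous_Cmult; [apply continuous_const | apply continuous_circ].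
      - intros s t Hs _; unfold Phis.
        rewrite Cmod_mult, Cmod_R, Rabs_pos_eq by lra.
        generalize (Hcp2 t) (Cmod_ge_0 (circ t - p)); nra.
      - intros s t Hs _; unfold Phit; specialize (Hrho s Hs).
        rewrite !Cmod_mult, Cmod_circ, Htau, Cmod_R, Rabs_pos_eq by lra.
        generalize PI_4; nra.
      - intros s t Hs _; apply Hg; auto. }
    unfold square_integral in G; rewrite Rplus_0_l in G.
    assert (Etb : (fun s => (g (Phi s 1) * Phis s 1)%C)
                  = (fun s => (g (Phi s 0) * Phis s 0)%C)).
    { unfold Phi, Phis; rewrite circ_0, circ_1; reflexivity. }
    rewrite Etb in G.
    assert (Eout : CInt (fun t => (g (Phi 1 t) * Phit 1 t)%C) 0 1
                   = (tau * X)%C).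
    { apply is_CInt_eq.
      apply is_CInt_ext with
        (fun t => (tau * (circ t * H (circ t) / (circ t - p) ^ S m))%C); [lra| |].
      - intros t _; unfold Phi, Phit, rho, g.
        replace (e + (1 - e) * 1) with 1 by ring.
        replace (p + 1 * (circ t - p))%C with (circ t) by ring.
        unfold Cdiv; ring.
      - apply is_CInt_scal; exact HX. }
    rewrite Eout in G.
    assert (E : (tau * X)%C = CInt (fun t => (g (Phi 0 t) * Phit 0 t)%C) 0 1).
    { set (b := CInt (fun s => (g (Phi s 0) * Phis s 0)%C) 0 1) in G.
      set (c := CInt (fun t => (g (Phi 0 t) * Phit 0 t)%C) 0 1) in *.
      replace (tau * X)%C with (b + tau * X - b - c + c)%C by ring.
      rewrite G; ring. }
    rewrite E.
    replace (8 * eta / (1 - Cmod p)) with ((1 - 0) * (8 * eta / (1 - Cmod p)))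
      by ring.
    apply Cmod_CInt_le_const with (fun t => (g (Phi 0 t) * Phit 0 t)%C); [lra| |].
    - intros t _; unfold Phit, g.
      assert (Ew : (Phi 0 t - p)%C = (RtoC e * (circ t - p))%C).
      { unfold Phi, rho; rewrite Rmult_0_r, Rplus_0_r; ring. }
      assert (Emod : Cmod (Phi 0 t - p) = e * Cmod (circ t - p)).
      { rewrite Ew, Cmod_mult, Cmod_R, Rabs_pos_eq by lra; reflexivity. }
      assert (Hmod : 0 < Cmod (Phi 0 t - p))
        by (rewrite Emod; generalize (Hgap t); nra).
      assert (Hb := Hw (Phi 0 t)
        ltac:(rewrite Emod; generalize (Hcp2 t) (Hgap t); nra)).
      rewrite Cmod_mult, Cmod_div
        by (apply Cpow_nz, Cmod_neq_0; exact Hmod).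
      rewrite !Cmod_mult, Cmod_circ, Htau, Cmod_R, Cmod_pow.
      unfold rho; rewrite Rmult_0_r, Rplus_0_r, Rabs_pos_eq by lra.
      set (d := Cmod (Phi 0 t - p)) in *.
      assert (Hdm : 0 < d ^ m) by (apply pow_lt; exact Hmod).
      assert (H1 : Cmod (H (Phi 0 t)) / d ^ S m <= eta / d).
      { apply Rmult_le_reg_r with (d ^ S m); [apply pow_lt; exact Hmod|].
        simpl; field_simplify; try lra. }
      apply Rle_trans with (eta / d * (e * 8)).
      + apply Rmult_le_compat; try assumption.
        * apply Rmult_le_pos; [apply Cmod_ge_0|].
          left; apply Rinv_0_lt_compat, pow_lt; exact Hmod.
        * nra.
        * generalize PI_4; nra.
      + rewrite Emod.
        replace (eta / (e * Cmod (circ t - p)) * (e * 8))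
          with (8 * eta / Cmod (circ t - p))
          by (field; generalize (Hgap t); lra).
        apply Rmult_le_compat_l; [lra|].
        apply Rinv_le_contravar; [lra | apply Hgap].
    - apply is_CInt_CInt; [lra|]; intros t _.
      apply continuous_Cmult.
      + apply continuous_comp;
          [|apply Cdiff_continuous, Hg; [apply Hin|apply Hne]; lra].
        unfold Phi; apply continuous_Cplus; [apply continuous_const|].
        apply continuous_Cmult; [apply continuous_const|].
        apply continuous_Cplus; [apply continuous_circ | apply continuous_const].
      + unfold Phit.
        apply continuous_Cmult; [apply continuous_const|].
        apply continuous_Cmult; [apply continuous_const | apply continuous_circ]. }
  assert (Hz : Cmod (tau * X) = 0).
  { destruct (Rle_lt_or_eq_dec 0 _ (Cmod_ge_0 (tau * X))) as [Hpos|Heq]; [|auto].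
    assert (Heta : 0 < Cmod (tau * X) * (1 - Cmod p) / 16) by nra.
    specialize (Hsmall _ Heta).
    replace (8 * (Cmod (tau * X) * (1 - Cmod p) / 16) / (1 - Cmod p))
      with (Cmod (tau * X) / 2) in Hsmall by (field; lra).
    lra. }
  rewrite Cmod_mult, Htau in Hz.
  apply Cmod_eq_0; nra.
Qed.

(** * Products of Blaschke factors and interpolation *)

Definition cprod {A : Type} (f : A -> C) (l : list A) : C :=
  fold_right Cmult 1 (map f l).

Lemma cprod_nz {A : Type} (f : A -> C) (l : list A) :
  (forall a, In a l -> f a <> 0) -> cprod f l <> 0.
Proof.
  intros Hf; induction l as [|a l IH]; unfold cprod; simpl.
  - intros E; apply RtoC_inj in E; lra.
  - apply Cmult_neq_0; [|apply IH]; intros; apply Hf; simpl; auto.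
Qed.

Lemma Cdiff_cprod {A : Type} (f : A -> C -> C) (l : list A) (z : C) :
  (forall a, In a l -> Cdiff (f a) z) ->
  Cdiff (fun w => cprod (fun a => f a w) l) z.
Proof.
  intros Hf; induction l as [|a l IH]; unfold cprod; simpl.
  - apply Cdiff_const.
  - apply Cdiff_mult; [|apply IH]; intros; apply Hf; simpl; auto.
Qed.

Lemma Cdiff_shift (a z : C) : Cdiff (fun w => (w - a)%C) z.
Proof. apply Cdiff_minus; [apply Cdiff_id | apply Cdiff_const]. Qed.

(** The factors [1 - conj a * z] are the denominators of Blaschke products. *)
Definition kernel (a z : C) : C := (1 - Cconj a * z)%C.

Lemma Cdiff_kernel (a z : C) : Cdiff (kernel a) z.
Proof.
  apply Cdiff_minus; [apply Cdiff_const|].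
  apply Cdiff_mult; [apply Cdiff_const | apply Cdiff_id].
Qed.

Lemma Cmod_kernel_ge (a z : C) :
  Cmod z <= 1 -> 1 - Cmod a <= Cmod (kernel a z).
Proof.
  intros Hz; unfold kernel.
  generalize (Cmod_triangle (1 - Cconj a * z) (Cconj a * z)).
  replace (1 - Cconj a * z + Cconj a * z)%C with (RtoC 1) by ring.
  rewrite Cmod_1, Cmod_mult, Cmod_conj.
  generalize (Cmod_ge_0 a) (Cmod_ge_0 z); nra.
Qed.

Lemma kernel_nz (a z : C) : Cmod a < 1 -> Cmod z <= 1 -> kernel a z <> 0.
Proof.
  intros Ha Hz; apply Cmod_neq_0; generalize (Cmod_kernel_ge a z Hz); lra.
Qed.

Lemma kernel_circ (a : C) (t : R) :
  kernel a (circ t) = (circ t * Cconj (circ t - a))%C.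
Proof.
  unfold kernel; rewrite Cminus_conj, Cconj_circ; field; apply circ_nz.
Qed.

Lemma cprod_kernel_circ (l : list C) (t : R) :
  cprod (fun a => kernel a (circ t)) l
  = (circ t ^ length l * Cconj (cprod (fun a => circ t - a)%C l))%C.
Proof.
  induction l as [|a l IH]; unfold cprod in *; simpl.
  - apply injective_projections; simpl; ring.
  - rewrite IH, kernel_circ, Cmult_conj; ring.
Qed.

Lemma circ_shift_nz (a : C) (t : R) : Cmod a < 1 -> (circ t - a)%C <> 0.
Proof.
  intros Ha; apply Cmod_neq_0; generalize (circ_neq_interior a t Ha); lra.
Qed.

Lemma circle_integral_zero (H : C -> C) (p : C) :
  (forall z, Cmod z <= 1 -> Cdiff H z) -> Cmod p < 1 -> H p = 0 ->
  is_CInt (fun t => (circ t * H (circ t) / (circ t - p))%C) 0 1 0.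
Proof.
  intros HH Hp H0.
  apply is_CInt_ext with
    (fun t => (circ t * H (circ t) / (circ t - p) ^ 1)%C); [lra| |].
  - intros t _; rewrite Cpow_1_r; reflexivity.
  - apply circle_integral_vanishing; try assumption.
    intros eta Heta.
    assert (Hc : continuous H p) by (apply Cdiff_continuous, HH; lra).
    destruct (proj1 (continuous_C_iff H p) Hc eta Heta) as [del [Hdel Hw]].
    exists del; split; [assumption|]; intros w Hwd.
    specialize (Hw w Hwd); rewrite H0 in Hw.
    replace (H w - 0)%C with (H w) in Hw by ring.
    rewrite pow_O; lra.
Qed.

(** Partial fractions reduce distinct simple poles to a single one. *)
Lemma circle_integral_distinct_zeros (pts : list C) :
  pts <> nil -> NoDup pts -> (forall p, In p pts -> Cmod p < 1) ->
  forall H : C -> C,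
  (forall z, Cmod z <= 1 -> Cdiff H z) -> (forall p, In p pts -> H p = 0) ->
  is_CInt (fun t => (circ t * H (circ t) / cprod (fun a => circ t - a)%C pts)%C)
    0 1 0.
Proof.
  remember (length pts) as n eqn:En; revert pts En.
  induction n as [|n IH]; intros pts En Hne Hnd Hin H HH Hz.
  - destruct pts; [congruence|discriminate].
  - destruct pts as [|p [|q r]]; [congruence| |].
    + apply is_CInt_ext with
        (fun t => (circ t * H (circ t) / (circ t - p))%C); [lra| |].
      * intros t _; unfold cprod; simpl; rewrite Cmult_1_r; reflexivity.
      * apply circle_integral_zero; [assumption| |]; auto with datatypes.
    + inversion Hnd as [|? ? Hp Hnd1]; subst.
      inversion Hnd1 as [|? ? Hq Hnd2]; subst.
      assert (Hpq : (p - q)%C <> 0).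
      { intros E; apply Hp; left.
        replace p with (p - q + q)%C by ring; rewrite E; ring. }
      assert (I1 : is_CInt (fun t => (circ t * H (circ t) /
          cprod (fun a => circ t - a)%C (p :: r))%C) 0 1 0).
      { apply IH; simpl in *; try congruence; auto.
        - constructor; [intros HI; apply Hp; auto | assumption].
        - intros x [Hx|Hx]; apply Hin; auto.
        - intros x [Hx|Hx]; apply Hz; auto. }
      assert (I2 : is_CInt (fun t => (circ t * H (circ t) /
          cprod (fun a => circ t - a)%C (q :: r))%C) 0 1 0).
      { apply IH; simpl in *; try congruence; auto. }
      assert (I3 := is_CInt_scal (/ (p - q)) _ _ _ _
        (is_CInt_minus _ _ _ _ _ _ I1 I2)).
      replace (/ (p - q) * (0 - 0))%C with (RtoC 0) in I3 by ring.
      revert I3; apply is_CInt_ext; [lra|]; intros t _.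
      assert (Hr : cprod (fun a => circ t - a)%C r <> 0).
      { apply cprod_nz; intros a Ha; apply circ_shift_nz, Hin; simpl; auto. }
      assert (Hpt : (circ t - p)%C <> 0)
        by (apply circ_shift_nz, Hin; simpl; auto).
      assert (Hqt : (circ t - q)%C <> 0)
        by (apply circ_shift_nz, Hin; simpl; auto).
      unfold cprod in *; simpl; field; auto.
Qed.

Lemma Re_mul_sqmod (z q : C) : Re (z * (q * Cconj q)) = Re z * Cmod q ^ 2.
Proof. rewrite <- Cmod2_conj; simpl; unfold Re; ring. Qed.

(** Rouche's theorem would give exactly [n] solutions of [z ^ n = h z].
    Dually: on the circle the function
    [z (z ^ n - h z) / (q z * prod (1 - conj p z))], [q = prod (z - p)],
    equals [(1 - h z * conj z ^ n) / |q z|^2], which has positive real part,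
    whereas its mean vanishes. *)
Lemma no_contractive_interpolation (n : nat) (h : C -> C) (pts : list C) :
  (forall z, Cmod z <= 1 -> Cdiff h z) ->
  (forall z, Cmod z = 1 -> Cmod (h z) < 1) ->
  length pts = S n -> NoDup pts -> (forall p, In p pts -> Cmod p < 1) ->
  ~ (forall p, In p pts -> h p = (p ^ n)%C).
Proof.
  intros Hh Hlt Hlen Hnd Hin Heq.
  set (H := fun z => ((z ^ n - h z) / cprod (fun a => kernel a z) pts)%C).
  assert (HH : forall z, Cmod z <= 1 -> Cdiff H z).
  { intros z Hz; apply Cdiff_div.
    - apply Cdiff_minus; [apply (Cdiff_pow (fun w => w)), Cdiff_id | auto].
    - apply Cdiff_cprod; intros; apply Cdiff_kernel.
    - apply cprod_nz; intros a Ha; apply kernel_nz; auto. }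
  assert (I : is_CInt (fun t =>
    (circ t * H (circ t) / cprod (fun a => circ t - a)%C pts)%C) 0 1 0).
  { apply circle_integral_distinct_zeros; try assumption.
    - intros E; rewrite E in Hlen; discriminate.
    - intros p Hp; unfold H; rewrite Heq by assumption.
      unfold Cdiv; ring. }
  assert (Hq : forall t, cprod (fun a => circ t - a)%C pts <> 0).
  { intros t; apply cprod_nz; intros a Ha; apply circ_shift_nz; auto. }
  revert I; apply is_CInt_Re_pos.
  - intros t _; apply continuous_Cmult; [apply continuous_Cmult|].
    + apply continuous_circ.
    + apply continuous_comp; [apply continuous_circ|].
      apply Cdiff_continuous, HH; rewrite Cmod_circ; lra.
    + apply (continuous_comp circ (fun z => / cprod (fun a => z - a)%C pts)%C);
        [apply continuous_circ|].
      apply continuous_Cinv; [|apply Hq].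
      apply Cdiff_continuous, (Cdiff_cprod (fun a w => w - a)%C).
      intros; apply Cdiff_shift.
  - intros t _; unfold H; rewrite cprod_kernel_circ, Hlen.
    set (q := cprod (fun a => circ t - a)%C pts).
    assert (Hqn : q <> 0) by apply Hq.
    assert (Hqc : Cconj q <> 0).
    { apply Cmod_neq_0; rewrite Cmod_conj; apply Cmod_gt_0; assumption. }
    replace (circ t * ((circ t ^ n - h (circ t)) / (circ t ^ S n * Cconj q)) / q)%C
      with ((1 - h (circ t) * Cconj (circ t) ^ n) * (/ q * Cconj (/ q)))%C.
    + rewrite Re_mul_sqmod; apply Rmult_lt_0_compat.
      * assert (Hm : Cmod (h (circ t) * Cconj (circ t) ^ n) < 1).
        { rewrite Cmod_mult, Cmod_pow, Cmod_conj, Cmod_circ, pow1, Rmult_1_r.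
          apply Hlt, Cmod_circ. }
        generalize (re_le_Cmod (h (circ t) * Cconj (circ t) ^ n)).
        generalize (Rle_abs (Re (h (circ t) * Cconj (circ t) ^ n))).
        generalize dependent (h (circ t) * Cconj (circ t) ^ n)%C.
        intros w Hw; unfold Cminus; simpl; unfold Re; lra.
      * apply pow_lt, Cmod_gt_0; intros E; apply Hqn.
        replace q with (q * (q * / q))%C by (field; assumption).
        rewrite E; ring.
    + rewrite Cconj_circ, Cinv_conj, Cpow_inv by (assumption || apply circ_nz).
      simpl; field; repeat split; try assumption; try apply circ_nz.
      apply Cpow_nz, circ_nz.
Qed.

(** * Schwarz's lemma to second order *)

Section Schwarz.

Variables (G : C -> C) (A : C).
Hypothesis HG : forall z, Cmod z <= 1 -> Cdiff G z.
Hypothesis HG1 : forall z, Cmod z <= 1 -> Cmod (G z) <= 1.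
Hypothesis HG0 : G 0 = 0.
Hypothesis HA : Cderive_at G 0 A.

Lemma Cderive_at_G_minus : Cderive_at (fun w => (G w + - A * w)%C) 0 0.
Proof.
  apply Cderive_at_eq with (A + - A)%C; [ring|].
  apply (Cderive_at_plus G (fun w => - A * w)%C);
    [exact HA | apply Cderive_at_scaled_id].
Qed.

Lemma schwarz_derivative : Cmod A <= 1.
Proof.
  assert (I := circle_integral_vanishing (fun w => (G w + - A * w)%C) 0 1).
  assert (I' : is_CInt (fun t =>
    (circ t * (G (circ t) + - A * circ t) / (circ t - 0) ^ 2)%C) 0 1 0).
  { apply I.
    - intros z Hz; apply Cdiff_plus; [auto|].
      eexists; apply Cderive_at_scaled_id.
    - rewrite Cmod_0; lra.
    - apply Cderive_at_order; [apply Cderive_at_G_minus|].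
      rewrite HG0; ring. }
  clear I.
  assert (J := is_CInt_plus _ _ _ _ _ _ I' (is_CInt_const_01 A)).
  rewrite Cplus_0_l in J.
  replace 1 with ((1 - 0) * 1) by ring.
  apply Cmod_CInt_le_const with (fun t => (G (circ t) / circ t)%C); [lra| |].
  - intros t _; rewrite Cmod_div, Cmod_circ by apply circ_nz.
    unfold Rdiv; rewrite Rinv_1, Rmult_1_r; apply HG1; rewrite Cmod_circ; lra.
  - revert J; apply is_CInt_ext; [lra|]; intros t _.
    replace (circ t - 0)%C with (circ t) by ring.
    simpl; field; apply circ_nz.
Qed.

(** The interpolation polynomial [A z + K z^2] of [G] at [0, 0, zeta] makes the
    integral of [(G - A z - K z^2) / (z^2 (z - zeta))] against the kernel
    [1 / (1 - conj zeta * z)] vanish; on the circle this exhibits [K] as the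
    mean of [(G - A z) / z^2] for the positive weight [1 / |z - zeta|^2]. *)
Lemma schwarz_second_order zeta :
  Cmod zeta < 1 -> Cmod (G zeta - A * zeta) <= 2 * Cmod zeta ^ 2.
Proof.
  intros Hz; destruct (Ceq_dec zeta 0) as [E0|Hnz].
  { rewrite E0, HG0.
    replace (0 - A * 0)%C with (RtoC 0) by ring; rewrite Cmod_0; lra. }
  set (K := ((G zeta - A * zeta) / (zeta * zeta))%C).
  set (N := fun w => ((G w + - A * w) + (- K * w) * w)%C).
  set (H := fun w => (N w * / kernel zeta w)%C).
  assert (HN : Cderive_at N 0 0).
  { apply Cderive_at_eq with (0 + (- K * 0 + (- K * 0) * 1))%C; [ring|].
    apply Cderive_at_plus; [apply Cderive_at_G_minus|].
    apply (Cderive_at_mult (fun w => - K * w)%C (fun w => w) 0 (- K) 1);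
      [apply Cderive_at_scaled_id|].
    apply Cderive_at_id. }
  assert (HN0 : N 0 = 0) by (unfold N; rewrite HG0; ring).
  assert (HNz : N zeta = 0) by (unfold N, K; field; assumption).
  assert (HH : forall z, Cmod z <= 1 -> Cdiff H z).
  { intros z Hz1; apply Cdiff_mult.
    - apply Cdiff_plus; [apply Cdiff_plus; [auto|]|].
      + eexists; apply Cderive_at_scaled_id.
      + apply Cdiff_mult; [eexists; apply Cderive_at_scaled_id | apply Cdiff_id].
    - apply Cdiff_inv; [apply Cdiff_kernel | apply kernel_nz; assumption]. }
  assert (HH1 : Cderive_at H 0 0).
  { destruct (Cdiff_inv (kernel zeta) 0 (Cdiff_kernel _ _)) as [k Hk].
    { apply kernel_nz; [assumption | rewrite Cmod_0; lra]. }
    apply Cderive_at_eq with (0 * / kernel zeta 0 + N 0 * k)%C;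
      [rewrite HN0; ring|].
    exact (Cderive_at_mult N (fun w => / kernel zeta w)%C 0 0 k HN Hk). }
  assert (I1 : is_CInt (fun t => (circ t * H (circ t) / (circ t - 0) ^ 2)%C)
                 0 1 0).
  { apply circle_integral_vanishing; [assumption|rewrite Cmod_0; lra|].
    apply Cderive_at_order; [assumption|]; unfold H; rewrite HN0; ring. }
  assert (I2 : is_CInt (fun t => (circ t * H (circ t) / (circ t - 0))%C) 0 1 0).
  { apply circle_integral_zero; [assumption|rewrite Cmod_0; lra|].
    unfold H; rewrite HN0; ring. }
  assert (I3 : is_CInt (fun t => (circ t * H (circ t) / (circ t - zeta))%C) 0 1 0).
  { apply circle_integral_zero; [assumption..|].
    unfold H; rewrite HNz; ring. }
  (* [1 / (z^2 (z - zeta))] is equal to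
     [(1 / (z - zeta) - 1 / z) / zeta^2 - 1 / (zeta z^2)] *)
  assert (I := is_CInt_minus _ _ _ _ _ _
    (is_CInt_scal (/ (zeta * zeta)) _ _ _ _ I3)
    (is_CInt_plus _ _ _ _ _ _ (is_CInt_scal (/ zeta) _ _ _ _ I1)
       (is_CInt_scal (/ (zeta * zeta)) _ _ _ _ I2))).
  clear I1 I2 I3; cbv beta in I.
  set (wt := fun t => / Cmod (circ t - zeta) ^ 2).
  assert (Hne : forall t, (circ t - zeta)%C <> 0)
    by (intros t; apply circ_shift_nz; assumption).
  assert (Hwpos : forall t, 0 < wt t).
  { intros t; apply Rinv_0_lt_compat, pow_lt, Cmod_gt_0, Hne. }
  assert (Ewt : forall t,
            RtoC (wt t) = (/ ((circ t - zeta) * Cconj (circ t - zeta)))%C).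
  { intros t; unfold wt; rewrite <- Cmod2_conj, RtoC_inv; [reflexivity|].
    apply Rgt_not_eq, pow_lt, Cmod_gt_0, Hne. }
  assert (Hwc : forall t, continuous wt t).
  { intros t.
    apply continuous_ext with
      (fun t => Re (/ ((circ t - zeta) * Cconj (circ t - zeta)))%C).
    - intros x; rewrite <- Ewt; reflexivity.
    - apply continuous_Re, continuous_Cinv.
      + assert (Hs : continuous (fun t => (circ t - zeta)%C) t).
        { apply continuous_Cplus;
            [apply continuous_circ | apply continuous_const]. }
        apply continuous_Cmult; [|apply continuous_Cconj]; exact Hs.
      + apply Cmult_neq_0; [apply Hne|].
        apply Cmod_neq_0; rewrite Cmod_conj; apply Cmod_gt_0, Hne. }
  assert (Hw0 : 0 < RInt wt 0 1) by (apply RInt_gt_0; auto; lra).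
  assert (Iw : is_RInt wt 0 1 (RInt wt 0 1)).
  { apply (RInt_correct (V := R_CompleteNormedModule)).
    apply (ex_RInt_continuous (V := R_CompleteNormedModule)); auto. }
  assert (IwC : is_CInt (fun t => RtoC (wt t)) 0 1 (RtoC (RInt wt 0 1))).
  { apply is_CInt_parts; split; [exact Iw|].
    assert (Z := is_RInt_const (V := R_NormedModule) 0 1 zero).
    assert (E : scal (1 - 0) (zero : R_NormedModule) = 0) by apply Rmult_0_r.
    rewrite E in Z; exact Z. }
  assert (J := is_CInt_plus _ _ _ _ _ _ I (is_CInt_scal K _ _ _ _ IwC)).
  cbv beta in J.
  replace (_ + K * RtoC (RInt wt 0 1))%C with (K * RtoC (RInt wt 0 1))%C in J
    by ring.
  assert (HK : Cmod (K * RtoC (RInt wt 0 1)) <= 2 * RInt wt 0 1).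
  { apply Cmod_CInt_le with
      (fun t => ((G (circ t) + - A * circ t) / (circ t * circ t) * RtoC (wt t))%C)
      (fun t => 2 * wt t) 0 1; [lra| | |].
    - intros t _; rewrite Cmod_mult, Cmod_R, Rabs_pos_eq by (left; auto).
      apply Rmult_le_compat_r; [left; auto|].
      rewrite Cmod_div by (apply Cmult_neq_0; apply circ_nz).
      rewrite Cmod_mult, Cmod_circ; unfold Rdiv.
      rewrite Rmult_1_r, Rinv_1, Rmult_1_r.
      eapply Rle_trans; [apply Cmod_triangle|].
      rewrite Cmod_mult, Cmod_opp, Cmod_circ.
      generalize schwarz_derivative (HG1 (circ t)); rewrite Cmod_circ; lra.
    - revert J; apply is_CInt_ext; [lra|]; intros t _.
      rewrite Ewt; unfold H, N; rewrite kernel_circ.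
      assert (H1 := circ_nz t); assert (H2 := Hne t).
      assert (H3 : Cconj (circ t - zeta)%C <> 0).
      { apply Cmod_neq_0; rewrite Cmod_conj; apply Cmod_gt_0, Hne. }
      replace (circ t - 0)%C with (circ t) by ring.
      revert H3; generalize (Cconj (circ t - zeta)%C); intros cc H3.
      simpl; field; auto.
    - exact (is_RInt_scal (V := R_NormedModule) _ _ _ 2 _ Iw). }
  rewrite Cmod_mult, Cmod_R, Rabs_pos_eq in HK by lra.
  assert (HK2 : Cmod K <= 2) by nra.
  replace (G zeta - A * zeta)%C with (K * (zeta * zeta))%C
    by (unfold K; field; assumption).
  rewrite !Cmod_mult.
  replace (2 * Cmod zeta ^ 2) with (2 * (Cmod zeta * Cmod zeta)) by ring.
  apply Rmult_le_compat_r; [|assumption].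
  apply Rmult_le_pos; apply Cmod_ge_0.
Qed.

End Schwarz.

(** * Rigidity of Blaschke products *)

Lemma blaschke_cprod (c : C) (alphas : list C) (z : C) :
  (forall a, In a alphas -> Cmod a < 1) -> Cmod z <= 1 ->
  blaschke c alphas z =
  (c * (- (1)) ^ length alphas * cprod (fun a => z - a)%C alphas
   / cprod (fun a => kernel a z) alphas)%C.
Proof.
  intros Ha Hz; unfold blaschke.
  induction alphas as [|a l IH]; unfold cprod in *; simpl.
  - field.
  - assert (Hl : fold_right Cmult 1 (map (fun a => kernel a z) l) <> 0).
    { apply (cprod_nz (fun a => kernel a z)); intros b Hb.
      apply kernel_nz; auto with datatypes. }
    assert (Hk : kernel a z <> 0) by (apply kernel_nz; auto with datatypes).
    fold (kernel a z).
    specialize (IH (fun b Hb => Ha b (or_intror Hb))).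
    rewrite Cmult_comm, <- Cmult_assoc, (Cmult_comm _ c), IH.
    field; auto.
Qed.

Lemma Cmod_cprod_kernel_le (l : list C) (z : C) :
  (forall a, In a l -> Cmod a < 1) -> Cmod z <= 1 ->
  Cmod (cprod (fun a => kernel a z) l) <= 2 ^ length l.
Proof.
  intros Ha Hz; induction l as [|a l IH]; unfold cprod in *; simpl.
  - rewrite Cmod_1; lra.
  - rewrite Cmod_mult; apply Rmult_le_compat; try apply Cmod_ge_0.
    + unfold kernel, Cminus; eapply Rle_trans; [apply Cmod_triangle|].
      rewrite Cmod_opp, Cmod_1, Cmod_mult, Cmod_conj.
      assert (Cmod a < 1) by auto with datatypes.
      generalize (Cmod_ge_0 a) (Cmod_ge_0 z); nra.
    + apply IH; auto with datatypes.
Qed.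

(** Let [Q] be the denominator of the Blaschke product [B], of degree [d].  On
    the circle [|Q|^2 (1 - h * conj B)] is equal, up to a unimodular constant,
    to [Q^2 (B - h) / z^d], whose mean vanishes because of the contact of order
    [d + 1] at the origin.  Its real part is nonnegative since [|h| <= 1], so it
    is zero, and [|h| >= 1].  This is the argument of
    [no_contractive_interpolation] with all the points at the origin. *)
Lemma blaschke_rigidity (c : C) (alphas : list C) (h : C -> C) (K : R) :
  Cmod c = 1 -> (forall a, In a alphas -> Cmod a < 1) ->
  (forall z, Cmod z <= 1 -> Cdiff h z) ->
  (forall z, Cmod z = 1 -> Cmod (h z) <= 1) ->
  (forall w, Cmod w < 1 ->
     Cmod (blaschke c alphas w - h w) <= K * Cmod w ^ S (length alphas)) ->
  forall t, 0 < t < 1 -> Cmod (h (circ t)) = 1.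
Proof.
  intros Hc Ha Hh Hh1 Hord t0 Ht0.
  set (d := length alphas).
  (* the sign turns the factors [a - z] of [B] into [z - a] *)
  set (c' := (c * (- (1)) ^ d)%C).
  assert (Hc' : Cmod c' = 1).
  { unfold c'; rewrite Cmod_mult, Cmod_pow, Cmod_opp, Cmod_1, pow1, Hc; ring. }
  set (P := fun z => cprod (fun a => z - a)%C alphas).
  set (Q := fun z => cprod (fun a => kernel a z) alphas).
  assert (HQ : forall z, Cmod z <= 1 -> Q z <> 0).
  { intros z Hz; apply cprod_nz; intros a Hal; apply kernel_nz; auto. }
  assert (HdP : forall z, Cdiff P z).
  { intros z; apply (Cdiff_cprod (fun a w => w - a)%C); intros.
    apply Cdiff_shift. }
  assert (HdQ : forall z, Cdiff Q z).
  { intros z; apply Cdiff_cprod; intros; apply Cdiff_kernel. }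
  set (W := fun z => (Q z * (c' * P z - Q z * h z))%C).
  assert (HW : forall z, Cmod z <= 1 -> Cdiff W z).
  { intros z Hz; apply Cdiff_mult; [auto|]; apply Cdiff_minus.
    - apply Cdiff_mult; [apply Cdiff_const | auto].
    - apply Cdiff_mult; auto. }
  assert (Hconv : forall z, Cmod z <= 1 ->
    W z = (Q z * Q z * (blaschke c alphas z - h z))%C).
  { intros z Hz; rewrite blaschke_cprod by assumption.
    fold d; fold c'; fold (P z); fold (Q z); unfold W; field; auto. }
  assert (I : is_CInt (fun t => (circ t * W (circ t) / (circ t - 0) ^ S d)%C)
                0 1 0).
  { apply circle_integral_vanishing; [assumption|rewrite Cmod_0; lra|].
    intros eta Heta.
    set (b := 2 ^ d * 2 ^ d * Rabs K + 1).
    assert (Hp2 : 0 < 2 ^ d) by (apply pow_lt; lra).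
    assert (Hb : 0 < b).
    { unfold b; generalize (Rabs_pos K); intros; nra. }
    exists (Rmin 1 (eta / b)); split.
    { apply Rmin_pos; [lra | apply Rdiv_lt_0_compat; assumption]. }
    intros w; replace (w - 0)%C with w by ring; intros Hw.
    assert (Hw1 : Cmod w < 1) by (eapply Rlt_le_trans; [exact Hw|apply Rmin_l]).
    assert (Hw2 : Cmod w < eta / b)
      by (eapply Rlt_le_trans; [exact Hw|apply Rmin_r]).
    rewrite Hconv by lra; rewrite !Cmod_mult.
    assert (HQ2 : Cmod (Q w) <= 2 ^ d)
      by (apply Cmod_cprod_kernel_le; [assumption|lra]).
    assert (Hm : 0 <= Cmod w ^ d) by (apply pow_le, Cmod_ge_0).
    apply Rle_trans with (2 ^ d * 2 ^ d * (Rabs K * (Cmod w ^ S d))).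
    - apply Rmult_le_compat; try apply Cmod_ge_0.
      + apply Rmult_le_pos; apply Cmod_ge_0.
      + apply Rmult_le_compat; auto using Cmod_ge_0.
      + eapply Rle_trans; [apply Hord; assumption|].
        apply Rmult_le_compat_r; [apply pow_le, Cmod_ge_0 | apply Rle_abs].
    - simpl pow at 3.
      replace (2 ^ d * 2 ^ d * (Rabs K * (Cmod w * Cmod w ^ d)))
        with (2 ^ d * 2 ^ d * Rabs K * Cmod w * Cmod w ^ d) by ring.
      apply Rmult_le_compat_r; [assumption|].
      apply Rle_trans with (b * Cmod w).
      + apply Rmult_le_compat_r; [apply Cmod_ge_0 | unfold b; lra].
      + left; apply Rmult_lt_reg_r with (/ b); [apply Rinv_0_lt_compat; lra|].
        replace (b * Cmod w * / b) with (Cmod w) by (field; lra).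
        exact Hw2. }
  set (f := fun t => (RtoC (Cmod (Q (circ t)) ^ 2)%R
    - Cconj (c' * P (circ t)) * Q (circ t) * h (circ t))%C).
  assert (HPQ : forall t, Q (circ t) = (circ t ^ d * Cconj (P (circ t)))%C)
    by (intros t; apply cprod_kernel_circ).
  assert (HPQm : forall t, Cmod (Q (circ t)) = Cmod (P (circ t))).
  { intros t; rewrite HPQ, Cmod_mult, Cmod_pow, Cmod_circ, pow1, Cmod_conj; ring. }
  assert (Hcc : (c' * Cconj c')%C = 1).
  { rewrite <- Cmod2_conj, Hc'; f_equal; ring. }
  assert (If : is_CInt f 0 1 0).
  { assert (I' := is_CInt_scal (Cconj c') _ _ _ _ I).
    rewrite Cmult_0_r in I'.
    revert I'; apply is_CInt_ext; [lra|]; intros t _; unfold f.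
    replace (circ t - 0)%C with (circ t) by ring.
    rewrite HPQm, Cmod2_conj, Cmult_conj.
    transitivity (Cconj c' * ((circ t ^ d * Cconj (P (circ t)))
       * (c' * P (circ t) - Q (circ t) * h (circ t))) / circ t ^ d)%C.
    - unfold W; rewrite (HPQ t) at 1; simpl; field.
      split; [apply Cpow_nz|]; apply circ_nz.
    - transitivity ((c' * Cconj c') * (P (circ t) * Cconj (P (circ t)))
         - Cconj c' * Cconj (P (circ t)) * Q (circ t) * h (circ t))%C.
      + field; apply Cpow_nz, circ_nz.
      + rewrite Hcc; ring. }
  assert (Hbound : forall t,
    Cmod (Cconj (c' * P (circ t)) * Q (circ t) * h (circ t))
    = Cmod (Q (circ t)) ^ 2 * Cmod (h (circ t))).
  { intros t; rewrite !Cmod_mult, Cmod_conj, Cmod_mult, Hc', <- HPQm; ring. }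
  assert (Hre : forall t, Re (f t) = Cmod (Q (circ t)) ^ 2
    - Re (Cconj (c' * P (circ t)) * Q (circ t) * h (circ t))).
  { intros t; unfold f; generalize (Cconj (c' * P (circ t)) * Q (circ t) * h (circ t))%C.
    intros u; unfold Cminus; simpl; unfold Re; ring. }
  assert (Hle : forall t, Cmod (h (circ t)) <= 1)
    by (intros t; apply Hh1, Cmod_circ).
  assert (Hsq : forall t, 0 < Cmod (Q (circ t)) ^ 2).
  { intros t; apply pow_lt, Cmod_gt_0, HQ; rewrite Cmod_circ; lra. }
  assert (Hz : Re (f t0) = 0).
  { apply is_CInt_Re_nonneg; try assumption.
    - intros t _; unfold f.
      assert (HcP : continuous (fun t => P (circ t)) t)
        by (apply continuous_comp; [apply continuous_circ|apply Cdiff_continuous; auto]).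
      assert (HcQ : continuous (fun t => Q (circ t)) t)
        by (apply continuous_comp; [apply continuous_circ|apply Cdiff_continuous; auto]).
      assert (Hch : continuous (fun t => h (circ t)) t).
      { apply continuous_comp; [apply continuous_circ|apply Cdiff_continuous, Hh].
        rewrite Cmod_circ; lra. }
      apply continuous_Cplus.
      + apply continuous_ext with (fun t => (Q (circ t) * Cconj (Q (circ t)))%C).
        * intros x; rewrite <- Cmod2_conj; reflexivity.
        * apply continuous_Cmult; [|apply continuous_Cconj]; assumption.
      + apply continuous_Copp, continuous_Cmult; [|assumption].
        apply continuous_Cmult; [|assumption].
        apply continuous_Cconj, continuous_Cmult; [apply continuous_const|assumption].
    - intros t _; rewrite Hre.
      generalize (re_le_Cmod (Cconj (c' * P (circ t)) * Q (circ t) * h (circ t))).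
      rewrite Hbound.
      generalize (Rle_abs (Re (Cconj (c' * P (circ t)) * Q (circ t) * h (circ t)))).
      generalize (Hle t) (Hsq t); nra. }
  rewrite Hre in Hz.
  generalize (re_le_Cmod (Cconj (c' * P (circ t0)) * Q (circ t0) * h (circ t0))).
  rewrite Hbound.
  generalize (Rle_abs (Re (Cconj (c' * P (circ t0)) * Q (circ t0) * h (circ t0)))).
  generalize (Hle t0) (Hsq t0); intros H1 H2 H3 H4.
  apply Rle_antisym; [assumption|nra].
Qed.

(** * Automorphisms of the disc *)

(** The involutive automorphism of the disc that exchanges [0] and [c]. *)
Definition moebius (c x : C) : C := ((c - x) * / kernel c x)%C.

Lemma Cmod_moebius (c x : C) : kernel c x <> 0 ->
  (1 - Cmod (moebius c x) ^ 2) * Cmod (kernel c x) ^ 2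
  = (1 - Cmod c ^ 2) * (1 - Cmod x ^ 2).
Proof.
  intros Hk; unfold moebius; rewrite Cmod_mult, Cmod_inv by assumption.
  assert (Hm : 0 < Cmod (kernel c x)) by (apply Cmod_gt_0; assumption).
  replace ((1 - (Cmod (c - x) * / Cmod (kernel c x)) ^ 2) * Cmod (kernel c x) ^ 2)
    with (Cmod (kernel c x) ^ 2 - Cmod (c - x) ^ 2) by (field; lra).
  rewrite !Cmod2_alt; destruct c, x; unfold kernel; simpl; unfold Re, Im; simpl.
  ring.
Qed.

Lemma moebius_kernel_pos (c x : C) : Cmod c < 1 -> Cmod x <= 1 ->
  0 < Cmod (kernel c x).
Proof. intros Hc Hx; apply Cmod_gt_0, kernel_nz; assumption. Qed.

Lemma Cmod_sqr_lt_1 (x : C) : Cmod x < 1 -> 0 < 1 - Cmod x ^ 2.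
Proof. generalize (Cmod_ge_0 x); simpl; nra. Qed.

Lemma moebius_le_1 (c x : C) : Cmod c < 1 -> Cmod x <= 1 ->
  Cmod (moebius c x) <= 1.
Proof.
  intros Hc Hx; assert (Hk := moebius_kernel_pos c x Hc Hx).
  assert (E := Cmod_moebius c x (Cmod_neq_0 _ Hk)).
  assert (H1 := Cmod_sqr_lt_1 c Hc).
  assert (H2 : 0 <= 1 - Cmod x ^ 2) by (generalize (Cmod_ge_0 x); simpl; nra).
  generalize (Cmod_ge_0 (moebius c x)); intros H3.
  assert (0 < Cmod (kernel c x) ^ 2) by (apply pow_lt; exact Hk).
  apply Rnot_lt_le; intros H4.
  assert (0 <= (1 - Cmod c ^ 2) * (1 - Cmod x ^ 2)) by (apply Rmult_le_pos; lra).
  assert (1 - Cmod (moebius c x) ^ 2 < 0) by (simpl; nra).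
  nra.
Qed.

Lemma moebius_unimodular (c x : C) : Cmod c < 1 -> Cmod x <= 1 ->
  Cmod (moebius c x) = 1 -> Cmod x = 1.
Proof.
  intros Hc Hx E1; assert (Hk := moebius_kernel_pos c x Hc Hx).
  assert (E := Cmod_moebius c x (Cmod_neq_0 _ Hk)).
  rewrite E1 in E.
  assert (H1 := Cmod_sqr_lt_1 c Hc).
  replace ((1 - 1 ^ 2) * Cmod (kernel c x) ^ 2) with 0 in E by ring.
  symmetry in E; apply Rmult_integral in E; destruct E as [E|E]; [lra|].
  generalize (Cmod_ge_0 x); simpl in E; nra.
Qed.

Lemma kernel_self_nz (c : C) : Cmod c < 1 -> (1 - Cconj c * c)%C <> 0.
Proof. intros Hc; apply (kernel_nz c c); lra. Qed.

Lemma moebius_involutive (c x : C) : Cmod c < 1 -> Cmod x <= 1 ->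
  moebius c (moebius c x) = x.
Proof.
  intros Hc Hx.
  assert (H1 := kernel_nz c x Hc Hx).
  assert (H2 := kernel_nz c _ Hc (moebius_le_1 c x Hc Hx)).
  assert (H3 := kernel_self_nz c Hc).
  unfold moebius, kernel in *.
  revert H1 H2 H3; generalize (Cconj c); intros cc H1 H2 H3.
  field; split; [assumption|].
  intros E; apply H3; rewrite <- E; ring.
Qed.

Lemma moebius_lipschitz (c x y : C) : Cmod c < 1 -> Cmod x <= 1 ->
  Cmod y <= 1 ->
  Cmod (moebius c x - moebius c y) <= / (1 - Cmod c) ^ 2 * Cmod (x - y).
Proof.
  intros Hc Hx Hy.
  assert (H1 := kernel_nz c x Hc Hx); assert (H2 := kernel_nz c y Hc Hy).
  replace (moebius c x - moebius c y)%C
    with ((1 - Cconj c * c) * / (kernel c x * kernel c y) * - (x - y))%C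
    by (unfold moebius, kernel in *; field; auto).
  rewrite !Cmod_mult, Cmod_opp, Cmod_inv, Cmod_mult
    by (apply Cmult_neq_0; assumption).
  apply Rmult_le_compat_r; [apply Cmod_ge_0|].
  assert (H3 := Cmod_kernel_ge c x Hx); assert (H4 := Cmod_kernel_ge c y Hy).
  assert (H5 : Cmod (1 - Cconj c * c) <= 1).
  { rewrite (Cmult_comm (Cconj c)), <- Cmod2_conj, <- RtoC_minus, Cmod_R.
    generalize (Cmod_ge_0 c) (Cmod_sqr_lt_1 c Hc); simpl; intros.
    rewrite Rabs_pos_eq; nra. }
  rewrite <- (Rmult_1_l (/ (1 - Cmod c) ^ 2)).
  apply Rmult_le_compat; try assumption; [apply Cmod_ge_0| |].
  - left; apply Rinv_0_lt_compat; apply Rmult_lt_0_compat; apply Cmod_gt_0; assumption.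
  - apply Rinv_le_contravar; [apply pow_lt; lra|].
    simpl; rewrite Rmult_1_r; apply Rmult_le_compat; lra.
Qed.

Lemma Cdiff_moebius (c : C) (f : C -> C) (z : C) :
  Cmod c < 1 -> Cmod (f z) <= 1 -> Cdiff f z ->
  Cdiff (fun w => moebius c (f w)) z.
Proof.
  intros Hc Hf Hd; apply Cdiff_mult.
  - apply Cdiff_minus; [apply Cdiff_const | assumption].
  - apply Cdiff_inv; [|apply kernel_nz; assumption].
    apply Cdiff_minus; [apply Cdiff_const|].
    apply Cdiff_mult; [apply Cdiff_const | assumption].
Qed.

Lemma Cderive_at_moebius (c d : C) (f : C -> C) (z : C) :
  Cmod c < 1 -> f z = c -> Cderive_at f z d ->
  Cderive_at (fun w => moebius c (f w)) z (- / (1 - Cconj c * c) * d)%C.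
Proof.
  intros Hc Hf Hd.
  destruct (Cdiff_inv (fun w => kernel c (f w)) z) as [k Hk].
  { apply Cdiff_minus; [apply Cdiff_const|].
    apply Cdiff_mult; [apply Cdiff_const | exists d; assumption]. }
  { rewrite Hf; apply kernel_nz; lra. }
  apply Cderive_at_eq with
    ((0 + - d) * / kernel c (f z) + (c - f z) * k)%C.
  - rewrite Hf; unfold kernel; field; apply kernel_self_nz; assumption.
  - apply (Cderive_at_mult (fun w => c - f w)%C (fun w => / kernel c (f w))%C);
      [|exact Hk].
    apply (Cderive_at_plus (fun _ => c) (fun w => - f w)%C);
      [apply Cderive_at_const | apply Cderive_at_opp; exact Hd].
Qed.

(** * Holomorphic functions on the ball *)

Lemma Cdiff_ex_filterdiff (f : C -> C) (z : C) :
  ex_filterdiff (U := C_NormedModule) (V := C_NormedModule) f (locally z) <->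
  Cdiff f z.
Proof.
  split.
  - intros [l Hl]; eexists; apply Cderive_at_filterdiff, Hl.
  - intros [l Hl]; eexists; apply filterdiff_Cderive_at, Hl.
Qed.

Lemma ex_filterdiff_pair (f g : C_NormedModule -> C_NormedModule)
    (z : C_NormedModule) :
  Cdiff f z -> Cdiff g z ->
  ex_filterdiff (fun w => (f w, g w) : C2) (locally z).
Proof.
  intros Hf Hg; apply Cdiff_ex_filterdiff in Hf, Hg.
  destruct Hf as [lf Hf], Hg as [lg Hg].
  exists (fun w => (lf w, lg w)).
  apply (filterdiff_comp'_2 (W := C2) f g (fun u v => (u, v)) z lf lg
           (fun u v => (u, v)) Hf Hg).
  apply filterdiff_ext with (fun t => t); [intros [u v]; reflexivity|].
  apply filterdiff_ext_lin with (fun t => t); [|intros [u v]; reflexivity].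
  apply filterdiff_id.
Qed.

Lemma Cdiff_components (g : C_NormedModule -> C2) (z : C_NormedModule) :
  ex_filterdiff g (locally z) ->
  Cdiff (fun w => fst (g w)) z /\ Cdiff (fun w => snd (g w)) z.
Proof.
  intros [l Hl]; split; apply Cdiff_ex_filterdiff.
  - exists (fun w => fst (l w)).
    apply (filterdiff_comp' g (fun p : C2 => fst p) z l (fun p => fst p) Hl).
    apply filterdiff_linear, is_linear_fst.
  - exists (fun w => snd (l w)).
    apply (filterdiff_comp' g (fun p : C2 => snd p) z l (fun p => snd p) Hl).
    apply filterdiff_linear, is_linear_snd.
Qed.

Lemma is_linear_Cmult_r (w : C) :
  is_linear (fun z : C_NormedModule => (z * w)%C : C_NormedModule).
Proof.
  split.
  - intros x y; apply Cmult_plus_distr_r.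
  - intros k x; symmetry; apply Cmult_assoc.
  - exists (Cmod w + 1); split; [generalize (Cmod_ge_0 w); lra|].
    intros x; change (Cmod (x * w) <= (Cmod w + 1) * Cmod x).
    rewrite Cmod_mult; generalize (Cmod_ge_0 x); lra.
Qed.

Lemma Cderive_at_slice (F l : C2 -> C_NormedModule) (w1 w2 z : C) :
  filterdiff F (locally ((z * w1)%C, (z * w2)%C)) l ->
  Cderive_at (fun x => F ((x * w1)%C, (x * w2)%C)) z (w1 * l (RtoC 1, RtoC 0)
    + w2 * l (RtoC 0, RtoC 1))%C.
Proof.
  intros Hl.
  apply Cderive_at_eq with (l ((1 * w1)%C, (1 * w2)%C)).
  - rewrite !Cmult_1_l.
    replace ((w1, w2) : C2) with
      (plus (scal w1 ((RtoC 1, RtoC 0) : C2)) (scal w2 ((RtoC 0, RtoC 1) : C2))).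
    + rewrite (linear_plus l (proj1 Hl)), !(linear_scal l (proj1 Hl)); reflexivity.
    + apply injective_projections; simpl.
      * change ((w1 * 1 + w2 * 0)%C = w1); ring.
      * change ((w1 * 0 + w2 * 1)%C = w2); ring.
  - apply (Cderive_at_filterdiff _ (fun x => l ((x * w1)%C, (x * w2)%C))).
    apply (filterdiff_comp' (U := C_NormedModule) (V := C2)
      (fun x : C_NormedModule => ((x * w1)%C, (x * w2)%C) : C2) F z
      (fun x : C_NormedModule => ((x * w1)%C, (x * w2)%C) : C2) l); [|exact Hl].
    apply filterdiff_linear.
    apply (is_linear_prod (U := C_NormedModule) (V := C_NormedModule));
      apply is_linear_Cmult_r.
Qed.

Lemma linear_form_norm_le_1 (al be : C) :
  (forall w1 w2, Cmod w1 ^ 2 + Cmod w2 ^ 2 < 1 ->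
     Cmod (al * w1 + be * w2) <= 1) ->
  Cmod al ^ 2 + Cmod be ^ 2 <= 1.
Proof.
  intros H; set (N := Cmod al ^ 2 + Cmod be ^ 2).
  apply Rnot_lt_le; intros HN.
  set (s := sqrt N).
  assert (Hs : s * s = N) by (apply sqrt_sqrt; lra).
  assert (Hs0 : 0 <= s) by apply sqrt_pos.
  assert (Hs1 : 1 < s) by nra.
  (* the vector [r * (conj al, conj be)] has norm [r * s] and is mapped to
     [r * N], so any [r] with [1 / N < r < 1 / s] will do *)
  set (r := (/ N + / s) / 2).
  assert (HrN : r * N = (1 + s) / 2)
    by (unfold r; rewrite <- Hs; field; lra).
  assert (Hrs : r * s = (1 + / s) / 2)
    by (unfold r; rewrite <- Hs; field; lra).
  assert (His : 0 < / s < 1).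
  { split; [apply Rinv_0_lt_compat; lra|].
    rewrite <- Rinv_1; apply Rinv_lt_contravar; lra. }
  assert (Hr : 0 <= r).
  { unfold r; assert (0 < / N) by (apply Rinv_0_lt_compat; lra); lra. }
  specialize (H (RtoC r * Cconj al)%C (RtoC r * Cconj be)%C).
  replace (al * (RtoC r * Cconj al) + be * (RtoC r * Cconj be))%C
    with (RtoC (r * N)) in H.
  - rewrite !Cmod_mult, !Cmod_conj, !Cmod_R, !Rabs_pos_eq in H by nra.
    assert (r * N <= 1); [apply H | lra].
    replace ((r * Cmod al) ^ 2 + (r * Cmod be) ^ 2) with ((r * s) * (r * s)).
    + rewrite Hrs; nra.
    + replace ((r * s) * (r * s)) with (r * r * (s * s)) by ring.
      rewrite Hs; unfold N; ring.
  - replace (al * (RtoC r * Cconj al) + be * (RtoC r * Cconj be))%C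
      with (RtoC r * (al * Cconj al + be * Cconj be))%C by ring.
    rewrite <- !Cmod2_conj, <- RtoC_plus, <- RtoC_mult; reflexivity.
Qed.

(** Schwarz's lemma to second order, on the slices of the ball; the error term
    is uniform in the direction [(w1, w2)]. *)
Lemma ball_first_order (F : C2 -> C_NormedModule) :
  holomorphic_on ball2 F -> maps_into ball2 Defs.disc F ->
  exists al be : C, Cmod al ^ 2 + Cmod be ^ 2 <= 1 /\
    forall w1 w2 zeta : C, Cmod w1 ^ 2 + Cmod w2 ^ 2 < 1 -> Cmod zeta < 1 ->
    Cmod (moebius (F (RtoC 0, RtoC 0)) (F ((zeta * w1)%C, (zeta * w2)%C))
          - (al * w1 + be * w2) * zeta) <= 2 * Cmod zeta ^ 2.
Proof.
  intros HF HFD; set (c0 := F (RtoC 0, RtoC 0)).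
  assert (Hb0 : ball2 (RtoC 0, RtoC 0)).
  { unfold ball2; simpl; rewrite Cmod_0; lra. }
  assert (Hc0 : Cmod c0 < 1) by (apply HFD, Hb0).
  destruct (HF _ Hb0) as [l Hl].
  set (kap := (- / (1 - Cconj c0 * c0))%C).
  exists (kap * l (RtoC 1, RtoC 0))%C, (kap * l (RtoC 0, RtoC 1))%C.
  set (G := fun w1 w2 z => moebius c0 (F ((z * w1)%C, (z * w2)%C))).
  assert (Hball : forall w1 w2 z, Cmod w1 ^ 2 + Cmod w2 ^ 2 < 1 -> Cmod z <= 1 ->
            ball2 ((z * w1)%C, (z * w2)%C)).
  { intros w1 w2 z Hw Hz; unfold ball2; simpl fst; simpl snd.
    rewrite !Cmod_mult, !Rpow_mult_distr.
    assert (Cmod z ^ 2 <= 1) by (generalize (Cmod_ge_0 z); simpl; nra).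
    assert (0 <= Cmod w1 ^ 2) by apply pow2_ge_0.
    assert (0 <= Cmod w2 ^ 2) by apply pow2_ge_0.
    nra. }
  assert (HGd : forall w1 w2 z, Cmod w1 ^ 2 + Cmod w2 ^ 2 < 1 -> Cmod z <= 1 ->
            Cdiff (G w1 w2) z).
  { intros w1 w2 z Hw Hz; specialize (Hball w1 w2 z Hw Hz).
    apply Cdiff_moebius; [assumption|left; apply HFD; assumption|].
    destruct (HF _ Hball) as [l' Hl']; eexists.
    apply Cderive_at_slice, Hl'. }
  assert (HG1 : forall w1 w2 z, Cmod w1 ^ 2 + Cmod w2 ^ 2 < 1 -> Cmod z <= 1 ->
            Cmod (G w1 w2 z) <= 1).
  { intros w1 w2 z Hw Hz; apply moebius_le_1; [assumption|].
    left; apply HFD, Hball; assumption. }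
  assert (Hz0 : forall w1 w2 : C, F ((0 * w1)%C, (0 * w2)%C) = c0).
  { intros w1 w2; unfold c0; rewrite !Cmult_0_l; reflexivity. }
  assert (HG0 : forall w1 w2, G w1 w2 0 = 0).
  { intros w1 w2; unfold G, moebius; rewrite Hz0; ring. }
  assert (HGA : forall w1 w2, Cderive_at (G w1 w2) 0
    (kap * l (RtoC 1, RtoC 0) * w1 + kap * l (RtoC 0, RtoC 1) * w2)%C).
  { intros w1 w2.
    apply Cderive_at_eq with
      (kap * (w1 * l (RtoC 1, RtoC 0) + w2 * l (RtoC 0, RtoC 1)))%C.
    { change ((kap * (w1 * l (RtoC 1, RtoC 0) + w2 * l (RtoC 0, RtoC 1)))%C =
        (kap * l (RtoC 1, RtoC 0) * w1 + kap * l (RtoC 0, RtoC 1) * w2)%C :> C).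
      ring. }
    apply (Cderive_at_moebius c0 _ (fun z => F ((z * w1)%C, (z * w2)%C)));
      [assumption|apply Hz0|].
    apply Cderive_at_slice; rewrite !Cmult_0_l; exact Hl. }
  split.
  - apply linear_form_norm_le_1; intros w1 w2 Hw.
    apply schwarz_derivative with (G w1 w2); auto.
  - intros w1 w2 zeta Hw Hzeta.
    apply (schwarz_second_order (G w1 w2)); auto.
Qed.

(** * The curve [(a z^k, b z^(k+1))] *)

Lemma Cmod_pow_le_1 (z : C) (n : nat) : Cmod z <= 1 -> Cmod (z ^ n) <= 1.
Proof.
  intros Hz; rewrite Cmod_pow, <- (pow1 n).
  apply pow_incr; split; [apply Cmod_ge_0 | assumption].
Qed.

Lemma cauchy_schwarz_pair (x y u v : R) :
  (x * u + y * v) ^ 2 <= (x ^ 2 + y ^ 2) * (u ^ 2 + v ^ 2).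
Proof. generalize (pow2_ge_0 (x * v - y * u)); simpl; nra. Qed.

Lemma Cmod_parallelogram (x y : C) :
  Cmod (x + y) ^ 2 + Cmod (x - y) ^ 2 = 2 * (Cmod x ^ 2 + Cmod y ^ 2).
Proof.
  rewrite !Cmod2_alt; destruct x, y; simpl; unfold Re, Im; simpl; ring.
Qed.

Section Curve.

Variables (k : nat) (a b : R).
Hypothesis Hk : (2 <= k)%nat.
Hypothesis Ha : 0 < a.
Hypothesis Hb : 0 < b.
Hypothesis Hab : a ^ 2 + b ^ 2 = 1.

Let f : C_NormedModule -> C2 :=
  fun l : C => (RtoC a * l ^ k, RtoC b * l ^ (k + 1))%C.

Lemma curve_holomorphic : holomorphic_on Defs.disc f.
Proof.
  intros z _; apply ex_filterdiff_pair;
    (apply Cdiff_mult;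
     [apply Cdiff_const | apply (Cdiff_pow (fun w => w)), Cdiff_id]).
Qed.

Lemma curve_direction_in_ball (z : C) :
  Cmod z < 1 -> Cmod (RtoC a) ^ 2 + Cmod (RtoC b * z) ^ 2 < 1.
Proof.
  intros Hz; rewrite Cmod_mult, !Cmod_R, !Rabs_pos_eq, Rpow_mult_distr by lra.
  assert (Cmod z ^ 2 < 1) by (generalize (Cmod_sqr_lt_1 z Hz); lra).
  assert (0 < b ^ 2) by (apply pow_lt; assumption); nra.
Qed.

Lemma curve_factor (z : C) :
  f z = ((z ^ k * RtoC a)%C, (z ^ k * (RtoC b * z))%C).
Proof.
  unfold f; rewrite Cpow_add_r, Cpow_1_r; f_equal; ring.
Qed.

Lemma curve_into_ball : maps_into Defs.disc ball2 f.
Proof.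
  intros z Hz; unfold Defs.disc in Hz.
  rewrite curve_factor; unfold ball2; simpl fst; simpl snd.
  rewrite Cmod_mult, (Cmod_mult _ (RtoC b * z)), !Rpow_mult_distr.
  assert (H1 := curve_direction_in_ball z Hz).
  assert (H2 : Cmod (z ^ k) <= 1) by (apply Cmod_pow_le_1; lra).
  assert (H3 : Cmod (z ^ k) ^ 2 <= 1)
    by (generalize (Cmod_ge_0 (z ^ k)); simpl; nra).
  generalize (pow2_ge_0 (Cmod (RtoC a))) (pow2_ge_0 (Cmod (RtoC b * z))); nra.
Qed.

(** The scalar function [a * z * g1 + b * g2] is [<g, f>] on the circle, up to
    the factor [conj z ^ (k + 1)]; it sends the interpolation problem for [f]
    to one for [z ^ (k + 1)]. *)
Lemma curve_extremal : extremal ball2 (k + 2) f.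
Proof.
  split; [apply curve_holomorphic|split; [apply curve_into_ball|]].
  intros pts Hlen Hnd Hin [Omega [g [_ [Hsub [Hg [Hgb Hint]]]]]].
  assert (Hd := fun z (Hz : Cmod z <= 1) => Cdiff_components g z (Hg z (Hsub z Hz))).
  apply (no_contractive_interpolation (k + 1)
    (fun z => RtoC a * z * fst (g z) + RtoC b * snd (g z))%C pts).
  - intros z Hz; destruct (Hd z Hz) as [H1 H2].
    apply Cdiff_plus; apply Cdiff_mult; try assumption; [|apply Cdiff_const].
    apply Cdiff_mult; [apply Cdiff_const | apply Cdiff_id].
  - intros z Hz.
    assert (Hball : ball2 (g z)) by (apply Hgb, Hsub; unfold closed_disc; lra).
    unfold ball2 in Hball.
    eapply Rle_lt_trans; [apply Cmod_triangle|].
    rewrite !Cmod_mult, !Cmod_R, Hz, !Rabs_pos_eq, Rmult_1_r by lra.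
    assert (H := cauchy_schwarz_pair a b (Cmod (fst (g z))) (Cmod (snd (g z)))).
    rewrite Hab, Rmult_1_l in H.
    apply Rnot_le_lt; intros H1.
    assert (1 <= (a * Cmod (fst (g z)) + b * Cmod (snd (g z))) ^ 2).
    { rewrite <- (pow1 2); apply pow_incr; lra. }
    lra.
  - transitivity (k + 2)%nat; [exact Hlen | lia].
  - exact Hnd.
  - exact Hin.
  - intros p Hp; rewrite Hint by assumption; unfold f; simpl fst; simpl snd.
    assert (E : (RtoC a * RtoC a + RtoC b * RtoC b)%C = 1).
    { rewrite <- !RtoC_mult, <- RtoC_plus; f_equal; simpl in Hab; lra. }
    rewrite Cpow_add_r, Cpow_1_r.
    transitivity ((RtoC a * RtoC a + RtoC b * RtoC b) * (p ^ k * p))%C; [ring|].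
    rewrite E; ring.
Qed.

(** After a disc automorphism [F] has the linear part [al * z1 + be * z2] at
    the origin.  As [2 * k >= k + 2], composing it with [f] and undoing the
    automorphism gives a function [h] that agrees with [F o f] to order
    [k + 2], so that [al * a + be * b * z] is unimodular on the circle by
    rigidity; the values at two opposite points contradict
    [|al|^2 + |be|^2 <= 1]. *)
Lemma curve_not_geodesic : ~ complex_geodesic ball2 (k + 2) f.
Proof.
  intros [_ [_ [F [HF [HFD [[d [Hd [c [alphas [Hc [Hlen [Hal HB]]]]]]] _]]]]]].
  destruct (ball_first_order F HF HFD) as [al [be [Hnorm Happrox]]].
  set (c0 := F (RtoC 0, RtoC 0)) in *.
  assert (Hc0 : Cmod c0 < 1).
  { apply HFD; unfold ball2; simpl; rewrite Cmod_0; lra. }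
  set (A := (al * RtoC a)%C); set (B := (be * RtoC b)%C).
  set (L := fun z => ((A + B * z) * z ^ k)%C).
  assert (HmA : Cmod A = Cmod al * a)
    by (unfold A; rewrite Cmod_mult, Cmod_R, Rabs_pos_eq; lra).
  assert (HmB : Cmod B = Cmod be * b)
    by (unfold B; rewrite Cmod_mult, Cmod_R, Rabs_pos_eq; lra).
  assert (Hlin : forall z, Cmod z <= 1 -> Cmod (A + B * z) <= 1).
  { intros z Hz; eapply Rle_trans; [apply Cmod_triangle|].
    rewrite Cmod_mult.
    assert (H := cauchy_schwarz_pair (Cmod al) (Cmod be) a b).
    rewrite Hab, Rmult_1_r, <- HmA, <- HmB in H.
    generalize (Cmod_ge_0 A) (Cmod_ge_0 B) (Cmod_ge_0 z); intros.
    assert (Cmod A + Cmod B <= 1) by (simpl in H; nra).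
    nra. }
  assert (HL : forall z, Cmod z <= 1 -> Cmod (L z) <= 1).
  { intros z Hz; unfold L; rewrite Cmod_mult, <- (Rmult_1_r 1).
    apply Rmult_le_compat; auto using Cmod_ge_0, Cmod_pow_le_1. }
  assert (HdL : forall z, Cdiff L z).
  { intros z; apply Cdiff_mult; [|apply (Cdiff_pow (fun w => w)), Cdiff_id].
    apply Cdiff_plus; [apply Cdiff_const|].
    apply Cdiff_mult; [apply Cdiff_const | apply Cdiff_id]. }
  assert (Hrigid : forall t, 0 < t < 1 -> Cmod (moebius c0 (L (circ t))) = 1).
  { apply (blaschke_rigidity c alphas (fun z => moebius c0 (L z))
             (/ (1 - Cmod c0) ^ 2 * 2)); try assumption.
    - intros z Hz; apply Cdiff_moebius; auto.
    - intros z Hz; apply moebius_le_1; [assumption|]; apply HL; lra.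
    - intros w Hw; rewrite <- HB by exact Hw.
      assert (HFw : Cmod (F (f w)) <= 1)
        by (left; apply HFD, curve_into_ball; exact Hw).
      rewrite <- (moebius_involutive c0 (F (f w))) by assumption.
      eapply Rle_trans.
      { apply moebius_lipschitz; [assumption| |apply HL; lra].
        apply moebius_le_1; assumption. }
      assert (Hi : 0 < / (1 - Cmod c0) ^ 2)
        by (apply Rinv_0_lt_compat, pow_lt; lra).
      rewrite Rmult_assoc; apply Rmult_le_compat_l; [lra|].
      assert (Hwk : Cmod (w ^ k) < 1).
      { rewrite Cmod_pow; destruct k as [|j]; [lia|].
        apply Rle_lt_trans with (Cmod w); [|assumption].
        simpl; rewrite <- (Rmult_1_r (Cmod w)) at 3.
        apply Rmult_le_compat_l; [apply Cmod_ge_0|].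
        rewrite <- Cmod_pow; apply Cmod_pow_le_1; lra. }
      specialize (Happrox (RtoC a) (RtoC b * w)%C (w ^ k)%C
        (curve_direction_in_ball w Hw) Hwk).
      rewrite curve_factor.
      replace (L w) with ((al * RtoC a + be * (RtoC b * w)) * w ^ k)%C
        by (unfold L, A, B; ring).
      eapply Rle_trans; [exact Happrox|].
      apply Rmult_le_compat_l; [lra|].
      rewrite Cmod_pow, <- pow_mult.
      replace (k * 2)%nat with (S (length alphas) + (k * 2 - S (length alphas)))%nat
        by lia.
      rewrite pow_add.
      apply Rle_trans with (Cmod w ^ S (length alphas) * 1); [|lra].
      apply Rmult_le_compat_l; [apply pow_le, Cmod_ge_0|].
      rewrite <- Cmod_pow; apply Cmod_pow_le_1; lra. }
  assert (Hunit : forall t, 0 < t < 1 -> Cmod (A + B * circ t) = 1).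
  { intros t Ht; assert (Hct : Cmod (circ t) <= 1) by (rewrite Cmod_circ; lra).
    assert (E := moebius_unimodular c0 _ Hc0 (HL _ Hct) (Hrigid t Ht)).
    unfold L in E; rewrite Cmod_mult, Cmod_pow, Cmod_circ, pow1, Rmult_1_r in E.
    exact E. }
  assert (E1 := Hunit (/ 4) ltac:(lra)).
  assert (E2 := Hunit (/ 4 + / 2) ltac:(lra)).
  rewrite circ_half_turn in E2.
  replace (A + B * - circ (/ 4))%C with (A - B * circ (/ 4))%C in E2 by ring.
  assert (P := Cmod_parallelogram A (B * circ (/ 4))).
  rewrite E1, E2, (Cmod_mult B), Cmod_circ, Rmult_1_r, HmA, HmB in P.
  assert (Ha2 : 0 < a ^ 2) by (apply pow_lt; assumption).
  assert (Hb2 : 0 < b ^ 2) by (apply pow_lt; assumption).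
  rewrite !Rpow_mult_distr in P.
  generalize (pow2_ge_0 (Cmod al)) (pow2_ge_0 (Cmod be)).
  revert P Hnorm Hab Ha2 Hb2.
  generalize (a ^ 2) (b ^ 2) (Cmod al ^ 2) (Cmod be ^ 2).
  intros p q x y P Hxy Hpq Hp Hq Hx Hy.
  assert (E : x * q + y * p = x + y - 1) by nra.
  assert (Hx0 : x * q = 0) by nra.
  assert (Hy0 : y * p = 0) by nra.
  apply Rmult_integral in Hx0, Hy0; nra.
Qed.

End Curve.

Theorem proposition11 :
  forall (k : nat) (a1 : R),
    (2 <= k)%nat -> 0 < a1 < 1 ->
    let f : C_NormedModule -> C2 :=
      fun l : C => (RtoC a1 * l ^ k, RtoC (sqrt (1 - a1 ^ 2)) * l ^ (k + 1))%C in
    extremal ball2 (k + 2) f /\ ~ complex_geodesic ball2 (k + 2) f.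
Proof.
  intros k a1 Hk Ha1 f.
  assert (H : 0 < 1 - a1 ^ 2) by (simpl; nra).
  assert (Hb : 0 < sqrt (1 - a1 ^ 2)) by (apply sqrt_lt_R0; assumption).
  assert (Hab : a1 ^ 2 + sqrt (1 - a1 ^ 2) ^ 2 = 1)
    by (rewrite pow2_sqrt; lra).
  split.
  - apply curve_extremal; try assumption; lra.
  - apply curve_not_geodesic; try assumption; lra.
Qed.
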